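(* Let $\kappa>0$ and $0\le\lambda\le1$ be real numbers, put $\tau_\kappa=\frac{\kappa-\sqrt{\kappa^2+4}}{2}$, and let $f(z)=z+\sum_{n=2}^{\infty}a_nz^n$ belong to the class $\mathcal{PSL}_{\Sigma}^{\kappa}(\lambda;\tilde p_\kappa)$. Then $$|a_2|\le \frac{|\kappa\tau_\kappa|\sqrt{\kappa}}{\sqrt{\kappa^2\tau_\kappa(1+2\lambda-\lambda^2)+(\kappa-(\kappa^2+2)\tau_\kappa)(1+\lambda)^2}},$$ $$|a_3|\le \frac{|\kappa\tau_\kappa|\,(\kappa-2(\kappa^2+1)\tau_\kappa)(1+\lambda)^2}{2(1+2\lambda)\left[\kappa^2\tau_\kappa(1+2\lambda-\lambda^2)+(\kappa-(\kappa^2+2)\tau_\kappa)(1+\lambda)^2\right]},$$ and for every $\mu\in\mathbb{R}$: if $0\le|\mu-1|\le \dfrac{\kappa^2\tau_\kappa(1+2\lambda-\lambda^2)+(\kappa-(\kappa^2+2)\tau_\kappa)(1+\lambda)^2}{2\kappa^2|\tau_\kappa|(1+2\lambda)}$, then $$|a_3-\mu a_2^2|\le \frac{|\kappa\tau_\kappa|}{2+4\lambda};$$ if $|\mu-1|\ge \dfrac{\kappa^2\tau_\kappa(1+2\lambda-\lambda^2)+(\kappa-(\kappa^2+2)\tau_\kappa)(1+\lambda)^2}{2\kappa^2|\tau_\kappa|(1+2\lambda)}$, then $$|a_3-\mu a_2^2|\le \frac{|1-\mu|\,\kappa^3\tau_\kappa^2}{\kappa^2\tau_\kappa(1+2\l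ambda-\lambda^2)+(\kappa-(\kappa^2+2)\tau_\kappa)(1+\lambda)^2}.$$
   Context: Let $\mathbb{D}=\{z\in\mathbb{C}:|z|<1\}$. $\mathcal{A}$ is the class of functions analytic in $\mathbb{D}$ of the form $f(z)=z+\sum_{n=2}^\infty a_nz^n$. $\Sigma$ is the class of bi-univalent functions: those $f\in\mathcal{A}$ that are univalent (injective) in $\mathbb{D}$ and whose inverse $g=f^{-1}$ (defined near $0$, with $g(w)=w-a_2w^2+(2a_2^2-a_3)w^3-\cdots$) extends to an analytic univalent function on $\mathbb{D}$, still denoted $g$. Subordination: for $F,G$ analytic in $\mathbb{D}$, $F\prec G$ means that there is an analytic function $\omega:\mathbb{D}\to\mathbb{C}$ with $\omega(0)=0$, $|\omega(z)|<1$ and $F(z)=G(\omega(z))$ for all $z\in\mathbb{D}$. For $\kappa>0$ and $\tau_\kappa=\frac{\kappa-\sqrt{\kappa^2+4}}{2}$, let $$\tilde p_\kappa(z)=\frac{1+\tau_\kappa^2z^2}{1-\kappa\tau_\kappa z-\tau_\kappa^2z^2},\qquad z\in\mathbb{D}.$$ For $0\le\lambda\le1$, a function $f\in\Sigma$ belongs to $\mathcal{PSL}_{\Sigma}^{\kappa}(\lambda;\tilde p_\kappa)$ if, with $g=f^{-1}$, $$\frac{zf'(z)+\lambda z^2f''(z)}{(1-\lambda)f(z)+\lambda zf'(z)}\prec\tilde p_\kappa(z)\quad (z\in\mathbb{D})\qquad\text{and}\qquad \frac{wg'(w)+\lambda w^2g''(w)}{(1-\lambda)g(w)+\lambda wg'(w)}\prec\tilde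 p_\kappa(w)\quad (w\in\mathbb{D}),$$ where the quotients (assumed to define analytic functions in $\mathbb{D}$) take the value $1$ at the origin. *)

(* Defs.v *)
From Stdlib Require Export Reals.
From Coquelicot Require Export Coquelicot.

Open Scope R_scope.

Definition in_disk (z : C) : Prop := Cmod z < 1.

(* Complex differentiability: the normed module is [C] over [C], not the real
   normed module [C_R_NormedModule].  The total operator [C_derive] returns the
   complex derivative wherever this predicate gives its existence. *)
Definition analytic (f : C -> C) : Prop :=
  forall z : C, in_disk z -> @ex_derive C_AbsRing C_NormedModule f z.

Definition univalent (f : C -> C) : Prop :=
  analytic f /\
  forall z1 z2 : C, in_disk z1 -> in_disk z2 -> f z1 = f z2 -> z1 = z2.

(* f(z) = z + a_2 z^2 + a_3 z^3 + ...; the values [a 0] and [a 1] are not used. *)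
Definition normalized_expansion (a : nat -> C) (f : C -> C) : Prop :=
  forall z : C, in_disk z ->
    @is_series C_AbsRing C_NormedModule
      (fun n : nat => (a (n + 2)%nat * z ^ (n + 2))%C) (f z - z)%C.

Definition class_A (f : C -> C) : Prop :=
  analytic f /\ exists a : nat -> C, normalized_expansion a f.

(* [g] coincides near 0 with the inverse of [f : D -> f(D)], [f] being injective
   on the disk D.  Such a [g] analytic on D is unique on D, so the existential
   quantifier on [g] in [PSL] leaves no choice. *)
Definition inverse_near_0 (f g : C -> C) : Prop :=
  exists r : R, 0 < r /\
    forall w : C, Cmod w < r -> in_disk (g w) /\ f (g w) = w.

Definition bi_univalent (f g : C -> C) : Prop :=
  class_A f /\ univalent f /\ univalent g /\ inverse_near_0 f g.

Definition subordinate (F G : C -> C) : Prop :=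
  exists omega : C -> C,
    analytic omega /\ omega 0 = 0 /\
    forall z : C, in_disk z -> in_disk (omega z) /\ F z = G (omega z).

Definition tau (kappa : R) : R := (kappa - sqrt (kappa ^ 2 + 4)) / 2.

Definition p_tilde (kappa : R) (z : C) : C :=
  ((1 + tau kappa ^ 2 * z ^ 2) /
   (1 - kappa * tau kappa * z - tau kappa ^ 2 * z ^ 2))%C.

(* Division is total, but analyticity of this function on the disk excludes
   zeros of the denominator d(z) = (1 - lam) f(z) + lam z f'(z) other than 0:
   the numerator is z d'(z), so the quotient is unbounded near such a zero. *)
Definition PSL_quotient (lam : R) (f : C -> C) (z : C) : C :=
  if Ceq_dec z 0 then 1%C else
  ((z * C_derive f z + lam * z ^ 2 * C_derive (C_derive f) z) /
   ((1 - lam) * f z + lam * z * C_derive f z))%C.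

Definition PSL_condition (kappa lam : R) (f : C -> C) : Prop :=
  analytic (PSL_quotient lam f) /\
  subordinate (PSL_quotient lam f) (p_tilde kappa).

Definition PSL (kappa lam : R) (f : C -> C) : Prop :=
  exists g : C -> C,
    bi_univalent f g /\
    PSL_condition kappa lam f /\ PSL_condition kappa lam g.

(* Main.v *)
Require Import Defs.
From Stdlib Require Import Reals Lra Lia ClassicalEpsilon.
From Coquelicot Require Import Coquelicot.
Open Scope R_scope.

(** The two subordinations [F = p~ o omega], one for [f] and one for its inverse
    [g], are compared up to the order [z^2].  Let [c1, c2] and [d1, d2] be the
    first two coefficients of the two Schwarz functions.  The quotient of [f] is
    [1 + (1 + lam) a2 z + (2 (1 + 2 lam) a3 - (1 + lam)^2 a2^2) z^2 + ...]
    ([quotient_jet]), that of [g] is the same expression in the coefficients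
    [- a2] and [2 a2^2 - a3] ([inverse_jet]), and
    [p~ = 1 + kappa t z + (kappa^2 + 2) t^2 z^2 + ...] ([p_tilde_jet]).  Comparison
    gives [d1 = - c1] and, with
    [A = kappa^2 t (1 + 2 lam - lam^2) - (kappa^2 + 2) t (1 + lam)^2 > 0],
      [2 A a2^2 = kappa^3 t^2 (c2 + d2)],
      [4 (1 + 2 lam) (a3 - a2^2) = kappa t (c2 - d2)].

    The analytic input is the inequality [|c2| <= 1 - |c1|^2]
    ([schwarz_pick_second_coefficient]).  As [|c1|] is a multiple of [|a2|], it
    bounds [c2] and [d2] in terms of [a2], which turns [A] into the larger
    constant [B = A + kappa (1 + lam)^2] of the statement and gives
    [B |a2|^2 <= kappa^3 t^2].  The bound for [a3] follows by the triangle
    inequality, and the one for [a3 - mu a2^2] by maximizing an affine function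
    of [|a2|^2] ([coupled_bound]).

    A Schwarz function is only known to be complex differentiable, with no
    information on its derivative.  Its means over circles are therefore computed
    by a Goursat argument for closed differential forms in polar coordinates
    ([boundary_integral_closed_form]), whose only consequence used below is a
    maximum principle at the centre of the disk ([Re_at_centre_le]).  The
    coefficient inequality comes from that principle applied to one auxiliary
    function built from [omega].  The derivatives of [f] come from termwise
    differentiation of its power series, and those of [g] from [f (g w) = w]. *)

(** * Closed forms on rectangles *)

(** Differentiability at the single point, which is what complex
    differentiability provides, of the form [P dx + Q dy] with [P_y = Q_x]. *)
Definition closed_form_at (P Q : R -> R -> R) (x y : R) : Prop :=
  exists px py qy, differentiable_pt_lim P x y px py /\
                   differentiable_pt_lim Q x y py qy.

Definition closed_form_on (P Q : R -> R -> R) (a b c d : R) : Prop :=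
  forall x y, a <= x <= b -> c <= y <= d -> closed_form_at P Q x y.

Definition boundary_integral (P Q : R -> R -> R) (a b c d : R) : R :=
  (RInt (fun x => P x c) a b - RInt (fun x => P x d) a b) +
  (RInt (fun y => Q b y) c d - RInt (fun y => Q a y) c d).

Lemma differentiable_continuous_x P x y lx ly :
  differentiable_pt_lim P x y lx ly -> continuous (fun t => P t y) x.
Proof.
intros H.
apply (ex_derive_continuous (V := R_NormedModule)).
exists (lx * 1 + ly * 0); apply is_derive_Reals.
apply (derivable_pt_lim_comp_2d P (fun t => t) (fun _ => y) x lx ly 1 0 H).
- apply derivable_pt_lim_id.
- apply derivable_pt_lim_const.
Qed.

Lemma differentiable_continuous_y P x y lx ly :
  differentiable_pt_lim P x y lx ly -> continuous (fun t => P x t) y.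
Proof.
intros H.
apply (ex_derive_continuous (V := R_NormedModule)).
exists (lx * 0 + ly * 1); apply is_derive_Reals.
apply (derivable_pt_lim_comp_2d P (fun _ => x) (fun t => t) y lx ly 0 1 H).
- apply derivable_pt_lim_const.
- apply derivable_pt_lim_id.
Qed.

Lemma closed_form_ex_RInt_x P Q a b c d u v y :
  closed_form_on P Q a b c d -> a <= u <= v -> v <= b -> c <= y <= d ->
  ex_RInt (fun x => P x y) u v.
Proof.
intros H Hu Hv Hy; apply (ex_RInt_continuous (V := R_CompleteNormedModule)).
intros x; rewrite Rmin_left, Rmax_right by lra; intros Hx.
destruct (H x y) as (px & py & qy & HP & _); try lra.
exact (differentiable_continuous_x P x y px py HP).
Qed.

Lemma closed_form_ex_RInt_y P Q a b c d u v x :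
  closed_form_on P Q a b c d -> c <= u <= v -> v <= d -> a <= x <= b ->
  ex_RInt (fun y => Q x y) u v.
Proof.
intros H Hu Hv Hx; apply (ex_RInt_continuous (V := R_CompleteNormedModule)).
intros y; rewrite Rmin_left, Rmax_right by lra; intros Hy.
destruct (H x y) as (px & py & qy & _ & HQ); try lra.
exact (differentiable_continuous_y Q x y py qy HQ).
Qed.

Lemma boundary_integral_split P Q a b c d u m v p n q :
  closed_form_on P Q a b c d ->
  a <= u <= m -> m <= v <= b -> c <= p <= n -> n <= q <= d ->
  boundary_integral P Q u v p q =
  boundary_integral P Q u m p n + boundary_integral P Q m v p n +
  boundary_integral P Q u m n q + boundary_integral P Q m v n q.
Proof.
intros H H1 H2 H3 H4; unfold boundary_integral.
assert (CX : forall y, c <= y <= d -> RInt (fun x => P x y) u v =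
   RInt (fun x => P x y) u m + RInt (fun x => P x y) m v).
{ intros y Hy; symmetry.
  apply (RInt_Chasles (V := R_CompleteNormedModule) (fun x => P x y));
  eapply closed_form_ex_RInt_x; eauto; lra. }
assert (CY : forall x, a <= x <= b -> RInt (fun y => Q x y) p q =
   RInt (fun y => Q x y) p n + RInt (fun y => Q x y) n q).
{ intros x Hx; symmetry.
  apply (RInt_Chasles (V := R_CompleteNormedModule) (fun y => Q x y));
  eapply closed_form_ex_RInt_y; eauto; lra. }
rewrite (CX p), (CX q), (CY u), (CY v) by lra; ring.
Qed.

Lemma RInt_near_const (f : R -> R) a b k e s :
  a <= b -> b - a <= s -> 0 <= e -> ex_RInt f a b ->
  (forall t, a <= t <= b -> Rabs (f t - k) <= e) ->
  Rabs (RInt f a b - k * (b - a)) <= e * s.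
Proof.
intros Hab Hs He Hf H.
assert (E : RInt f a b - k * (b - a) = RInt (fun t => f t - k) a b).
{ rewrite (RInt_minus (V := R_CompleteNormedModule) f (fun _ => k)); auto.
  - rewrite RInt_const; unfold minus, plus, opp, scal; simpl; unfold mult; simpl; ring.
  - apply ex_RInt_const. }
rewrite E.
apply Rle_trans with ((b - a) * e).
- apply abs_RInt_le_const; auto.
  apply (ex_RInt_minus (V := R_NormedModule) f (fun _ => k)); auto.
  apply ex_RInt_const.
- rewrite Rmult_comm; apply Rmult_le_compat_l; lra.
Qed.

(** Opposite sides are compared with each other: on a small rectangle
    [P x p - P x q] is nearly the constant [- P_y (q - p)] and
    [Q v y - Q u y] nearly the constant [Q_x (v - u)], so that [P_y = Q_x]
    makes the two contributions cancel up to the linearization error. *)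
Lemma boundary_integral_small P Q a b c d u v p q s e P0 Q0 x0 y0 px py qy :
  closed_form_on P Q a b c d ->
  a <= u <= v -> v <= b -> c <= p <= q -> q <= d ->
  v - u <= s -> q - p <= s -> 0 <= e ->
  (forall x y, u <= x <= v -> p <= y <= q ->
     Rabs (P x y - P0 - (px * (x - x0) + py * (y - y0))) <= e /\
     Rabs (Q x y - Q0 - (py * (x - x0) + qy * (y - y0))) <= e) ->
  Rabs (boundary_integral P Q u v p q) <= 4 * e * s.
Proof.
intros H H1 H2 H3 H4 Hs1 Hs2 He HA; unfold boundary_integral.
rewrite <- (RInt_minus (V := R_CompleteNormedModule) (fun x => P x p) (fun x => P x q));
 [ | eapply closed_form_ex_RInt_x; eauto; lra ..].
rewrite <- (RInt_minus (V := R_CompleteNormedModule) (fun y => Q v y) (fun y => Q u y));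
 [ | eapply closed_form_ex_RInt_y; eauto; lra ..].
set (I1 := RInt _ u v); set (I2 := RInt _ p q).
assert (B1 : Rabs (I1 - (- (py * (q - p))) * (v - u)) <= 2 * e * s).
{ apply RInt_near_const; try lra.
  - apply (ex_RInt_minus (V := R_NormedModule) (fun x => P x p) (fun x => P x q));
      eapply closed_form_ex_RInt_x; eauto; lra.
  - intros t Ht; unfold minus, plus, opp; simpl.
    destruct (HA t p) as [A1 _]; try lra.
    destruct (HA t q) as [A2 _]; try lra.
    apply Rabs_le_between in A1; apply Rabs_le_between in A2.
    apply Rabs_le_between; lra. }
assert (B2 : Rabs (I2 - (py * (v - u)) * (q - p)) <= 2 * e * s).
{ apply RInt_near_const; try lra.
  - apply (ex_RInt_minus (V := R_NormedModule) (fun y => Q v y) (fun y => Q u y));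
      eapply closed_form_ex_RInt_y; eauto; lra.
  - intros t Ht; unfold minus, plus, opp; simpl.
    destruct (HA u t) as [_ A1]; try lra.
    destruct (HA v t) as [_ A2]; try lra.
    apply Rabs_le_between in A1; apply Rabs_le_between in A2.
    apply Rabs_le_between; lra. }
apply Rabs_le_between in B1; apply Rabs_le_between in B2.
apply Rabs_le_between; lra.
Qed.

Lemma nested_intervals_point (x h : nat -> R) :
  (forall n, x n <= x (S n)) -> (forall n, x (S n) + h (S n) <= x n + h n) ->
  (forall n, 0 <= h n) -> exists l, forall n, x n <= l <= x n + h n.
Proof.
intros H1 H2 H3.
assert (M1 : forall n k, x n <= x (n + k)%nat).
{ intros n k; induction k as [|k IH]; [rewrite Nat.add_0_r; lra|].
  rewrite Nat.add_succ_r; specialize (H1 (n + k)%nat); lra. }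
assert (M2 : forall n k, x (n + k)%nat + h (n + k)%nat <= x n + h n).
{ intros n k; induction k as [|k IH]; [rewrite Nat.add_0_r; lra|].
  rewrite Nat.add_succ_r; specialize (H2 (n + k)%nat); lra. }
assert (U : forall m n, x n <= x m + h m).
{ intros m n; destruct (Nat.le_ge_cases m n) as [L|L].
  - specialize (M2 m (n - m)%nat); replace (m + (n - m))%nat with n in M2 by lia.
    specialize (H3 n); lra.
  - specialize (M1 n (m - n)%nat); replace (n + (m - n))%nat with m in M1 by lia.
    specialize (H3 m); lra. }
destruct (completeness (fun r => exists n, r = x n)) as [l [L1 L2]].
- exists (x 0%nat + h 0%nat); intros r [n ->]; apply U.
- exists (x 0%nat); exists 0%nat; reflexivity.
- exists l; intros n; split.
  + apply L1; exists n; reflexivity.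
  + apply L2; intros r [k ->]; apply U.
Qed.

Lemma half_pow_small K d : 0 < d -> exists n : nat, K * (/ 2) ^ n < d.
Proof.
intros Hd.
destruct (pow_lt_1_zero (/ 2) ltac:(rewrite Rabs_right; lra) (d / (Rabs K + 1))) as [n Hn].
{ apply Rdiv_lt_0_compat; auto. pose proof (Rabs_pos K); lra. }
exists n; specialize (Hn n (le_n n)).
assert (P : 0 < (/ 2) ^ n) by (apply pow_lt; lra).
rewrite Rabs_right in Hn by lra.
pose proof (Rabs_pos K) as K0; pose proof (Rle_abs K) as K1.
apply Rmult_lt_compat_r with (r := Rabs K + 1) in Hn; [|lra].
unfold Rdiv in Hn; rewrite Rmult_assoc, Rinv_l, Rmult_1_r in Hn by lra.
nra.
Qed.

(** Goursat's argument.  If the integral over the boundary were nonzero, one of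
    the four quarters would carry at least a quarter of it; iterating gives
    nested rectangles of area [4 ^ -n] times the original with boundary integral
    at least [e / 4 ^ n].  At their common point differentiability bounds that
    integral by [o(4 ^ -n)]. *)
Theorem boundary_integral_closed_form P Q a b c d :
  a <= b -> c <= d -> closed_form_on P Q a b c d ->
  boundary_integral P Q a b c d = 0.
Proof.
intros Hab Hcd H.
set (e := Rabs (boundary_integral P Q a b c d)).
destruct (Req_dec e 0) as [E0|E0].
{ unfold e in E0; destruct (Req_dec (boundary_integral P Q a b c d) 0); auto.
  now apply Rabs_no_R0 in E0. }
exfalso.
assert (e_pos : 0 < e) by (pose proof (Rabs_pos (boundary_integral P Q a b c d)); fold e in H0; lra).
set (L := b - a); set (W := d - c).
(* [bad n z]: the cell of generation n with lower left corner z keeps its share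
   of the integral *)
set (bad := fun (n : nat) (z : R * R) =>
  (a <= fst z /\ fst z + L * (/ 2) ^ n <= b) /\
  (c <= snd z /\ snd z + W * (/ 2) ^ n <= d) /\
  e * (/ 4) ^ n <= Rabs (boundary_integral P Q (fst z) (fst z + L * (/ 2) ^ n)
                               (snd z) (snd z + W * (/ 2) ^ n))).
assert (L0 : 0 <= L) by (unfold L; lra).
assert (W0 : 0 <= W) by (unfold W; lra).
assert (step : forall n z, bad n z -> exists w, bad (S n) w /\
   (fst z <= fst w <= fst z + L * (/ 2) ^ S n /\
    snd z <= snd w <= snd z + W * (/ 2) ^ S n)).
{ intros n [x y] ((X1 & X2) & (Y1 & Y2) & Hb); simpl fst in *; simpl snd in *.
  set (h := L * (/ 2) ^ S n); set (k := W * (/ 2) ^ S n).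
  assert (h0 : 0 <= h) by (apply Rmult_le_pos; auto; apply pow_le; lra).
  assert (k0 : 0 <= k) by (apply Rmult_le_pos; auto; apply pow_le; lra).
  assert (Eh : L * (/ 2) ^ n = h + h) by (unfold h; simpl; field).
  assert (Ek : W * (/ 2) ^ n = k + k) by (unfold k; simpl; field).
  rewrite Eh, Ek in *.
  rewrite (boundary_integral_split P Q a b c d x (x + h) (x + (h + h)) y (y + k) (y + (k + k)))
    in Hb by (auto; lra).
  replace (x + (h + h)) with (x + h + h) in Hb by ring.
  replace (y + (k + k)) with (y + k + k) in Hb by ring.
  set (q := e * (/ 4) ^ S n).
  assert (Eq4 : e * (/ 4) ^ n = 4 * q) by (unfold q; simpl; field).
  rewrite Eq4 in Hb.
  assert (G : forall x' y', x <= x' <= x + h -> y <= y' <= y + k ->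
     q <= Rabs (boundary_integral P Q x' (x' + h) y' (y' + k)) ->
     exists w : R * R, bad (S n) w /\ x <= fst w <= x + h /\ y <= snd w <= y + k).
  { intros x' y' Hx Hy Hq; exists (x', y'); unfold bad; simpl fst; simpl snd.
    fold h k q; repeat split; auto; lra. }
  set (B1 := boundary_integral P Q x (x + h) y (y + k)) in *.
  set (B2 := boundary_integral P Q (x + h) (x + h + h) y (y + k)) in *.
  set (B3 := boundary_integral P Q x (x + h) (y + k) (y + k + k)) in *.
  set (B4 := boundary_integral P Q (x + h) (x + h + h) (y + k) (y + k + k)) in *.
  destruct (Rle_dec q (Rabs B1)); [apply (G x y); auto; lra|].
  destruct (Rle_dec q (Rabs B2)); [apply (G (x + h) y); auto; lra|].
  destruct (Rle_dec q (Rabs B3)); [apply (G x (y + k)); auto; lra|].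
  destruct (Rle_dec q (Rabs B4)); [apply (G (x + h) (y + k)); auto; lra|].
  exfalso.
  pose proof (Rabs_triang (B1 + B2 + B3) B4).
  pose proof (Rabs_triang (B1 + B2) B3).
  pose proof (Rabs_triang B1 B2).
  lra. }
assert (start : bad 0%nat (a, c)).
{ unfold bad; simpl fst; simpl snd; simpl pow; rewrite !Rmult_1_r.
  replace (a + L) with b by (unfold L; ring).
  replace (c + W) with d by (unfold W; ring).
  fold e; repeat split; lra. }
pose (nxt := fun n (z : {z | bad n z}) =>
  let w := constructive_indefinite_description _ (step n (proj1_sig z) (proj2_sig z)) in
  exist (bad (S n)) (proj1_sig w) (proj1 (proj2_sig w))).
pose (sq := fix sq n := match n return {z | bad n z} with
   | O => exist (bad O) (a, c) start | S m => nxt m (sq m) end).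
assert (sqS : forall n, 
    fst (proj1_sig (sq n)) <= fst (proj1_sig (sq (S n)))
      <= fst (proj1_sig (sq n)) + L * (/ 2) ^ S n /\
    snd (proj1_sig (sq n)) <= snd (proj1_sig (sq (S n)))
      <= snd (proj1_sig (sq n)) + W * (/ 2) ^ S n).
{ intros n; simpl (sq (S n)); unfold nxt; cbv zeta; simpl (proj1_sig (exist _ _ _)).
  destruct (constructive_indefinite_description _ _) as [w [Hw1 Hw2]]; exact Hw2. }
assert (half : forall K n, K * (/ 2) ^ n = 2 * (K * (/ 2) ^ S n)) by (intros; simpl; field).
assert (pos2 : forall K n, 0 <= K -> 0 <= K * (/ 2) ^ n)
  by (intros; apply Rmult_le_pos; auto; apply pow_le; lra).
destruct (nested_intervals_point (fun n => fst (proj1_sig (sq n)))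
                                  (fun n => L * (/ 2) ^ n)) as [x0 Hx0].
{ intros n; apply (sqS n). }
{ intros n; specialize (sqS n); rewrite (half L n); lra. }
{ intros n; auto. }
destruct (nested_intervals_point (fun n => snd (proj1_sig (sq n)))
                                  (fun n => W * (/ 2) ^ n)) as [y0 Hy0].
{ intros n; apply (sqS n). }
{ intros n; specialize (sqS n); rewrite (half W n); lra. }
{ intros n; auto. }
assert (B0 := proj2_sig (sq 0%nat)).
destruct (H x0 y0) as (px & py & qy & HP & HQ).
{ specialize (Hx0 0%nat); cbv beta in Hx0; destruct B0 as ((? & ?) & _); lra. }
{ specialize (Hy0 0%nat); cbv beta in Hy0; destruct B0 as (_ & (? & ?) & _); lra. }
set (D := L + W + 1).
assert (D0 : 0 < D) by (unfold D; lra).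
(* with this eps the local bound 4 eps (D / 2^n)^2 is half of e / 4^n *)
assert (eps0 : 0 < e / (8 * (D * D))) by (apply Rdiv_lt_0_compat; nra).
set (eps := mkposreal _ eps0).
destruct (HP eps) as [d1 Hd1]; destruct (HQ eps) as [d2 Hd2].
destruct (half_pow_small D (Rmin d1 d2)) as [n Hn].
{ apply Rmin_glb_lt; [apply d1|apply d2]. }
assert (Bn := proj2_sig (sq n)).
specialize (Hx0 n); specialize (Hy0 n); cbv beta in Hx0, Hy0.
destruct (proj1_sig (sq n)) as [x y]; simpl fst in *; simpl snd in *.
destruct Bn as ((X1 & X2) & (Y1 & Y2) & Hb); simpl fst in *; simpl snd in *.
set (s := D * (/ 2) ^ n) in *.
assert (p2 : 0 < (/ 2) ^ n) by (apply pow_lt; lra).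
assert (s0 : 0 < s) by (unfold s; nra).
assert (Ls : L * (/ 2) ^ n <= s) by (unfold s, D; nra).
assert (Ws : W * (/ 2) ^ n <= s) by (unfold s, D; nra).
assert (Bd : Rabs (boundary_integral P Q x (x + L * (/ 2) ^ n) y (y + W * (/ 2) ^ n))
     <= 4 * (eps * s) * s).
{ pose proof (pos2 L n L0); pose proof (pos2 W n W0).
  apply (boundary_integral_small P Q a b c d _ _ _ _ s (eps * s) (P x0 y0) (Q x0 y0) x0 y0 px py qy);
   auto; try lra.
  { apply Rmult_le_pos; [left; apply eps|lra]. }
  intros u v Hu Hv.
  assert (Eu : Rabs (u - x0) <= s) by (apply Rabs_le_between; lra).
  assert (Ev : Rabs (v - y0) <= s) by (apply Rabs_le_between; lra).
  pose proof (Rmin_l d1 d2); pose proof (Rmin_r d1 d2).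
  assert (M : eps * Rmax (Rabs (u - x0)) (Rabs (v - y0)) <= eps * s).
  { apply Rmult_le_compat_l; [left; apply eps|]; apply Rmax_lub; auto. }
  split; (eapply Rle_trans; [|exact M]); [apply Hd1|apply Hd2]; lra. }
assert (E4 : (/ 4) ^ n = (/ 2) ^ n * (/ 2) ^ n).
{ rewrite <- Rpow_mult_distr; f_equal; field. }
rewrite E4 in Hb.
assert (E5 : 4 * (eps * s) * s = e / 2 * ((/ 2) ^ n * (/ 2) ^ n)).
{ unfold s, eps; simpl pos; field; lra. }
rewrite E5 in Bd.
assert (0 < e * ((/ 2) ^ n * (/ 2) ^ n)) by (apply Rmult_lt_0_compat; nra).
lra.
Qed.

(** * Complex derivatives and the mean over circles *)

(** Equivalent to [is_derive] over [C_AbsRing] ([is_derive_cderiv]), and free of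
    the choice between the two normed-module structures that [C] carries over
    itself. *)
Definition cderiv (f : C -> C) (z l : C) : Prop :=
  forall eps, 0 < eps -> exists d, 0 < d /\
    forall w, Cmod (w - z) < d -> Cmod (f w - f z - l * (w - z)) <= eps * Cmod (w - z).

Lemma Cmod_le_2Rmax (x y : R) : Cmod (x, y) <= 2 * Rmax (Rabs x) (Rabs y).
Proof.
eapply Rle_trans; [exact (Cmod_2Rmax (x, y))|].
apply Rmult_le_compat_r; [eapply Rle_trans; [apply Rabs_pos|apply Rmax_l]|].
rewrite <- (sqrt_pow2 2) at 2 by lra; apply sqrt_le_1; lra.
Qed.

Lemma im_le_Cmod (c : C) : Rabs (Im c) <= Cmod c.
Proof. eapply Rle_trans; [|apply Rmax_Cmod]; apply Rmax_r. Qed.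

Lemma cderiv_cauchy_riemann (f : C -> C) (x y : R) (l : C) :
  cderiv f (x, y) l ->
  differentiable_pt_lim (fun u v => Re (f (u, v))) x y (Re l) (- Im l) /\
  differentiable_pt_lim (fun u v => Im (f (u, v))) x y (Im l) (Re l).
Proof.
intros H.
assert (K : forall eps : posreal, locally_2d (fun u v =>
   Cmod (f (u, v) - f (x, y) - l * ((u, v) - (x, y)))%C
   <= eps * Rmax (Rabs (u - x)) (Rabs (v - y))) x y).
{ intros eps; destruct (H (eps / 2)) as (d & Hd & Hf).
  { pose proof (cond_pos eps); lra. }
  assert (Hd2 : 0 < d / 2) by lra.
  exists (mkposreal _ Hd2); simpl; intros u v Hu Hv.
  pose proof (Cmod_le_2Rmax (u - x) (v - y)) as B.
  change (u - x, v - y) with ((u, v) - (x, y))%C in B.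
  assert (Rmax (Rabs (u - x)) (Rabs (v - y)) < d / 2) by (apply Rmax_lub_lt; auto).
  eapply Rle_trans; [apply Hf; lra|].
  set (m := Rmax (Rabs (u - x)) (Rabs (v - y))) in *.
  replace (eps * m) with (eps / 2 * (2 * m)) by field.
  apply Rmult_le_compat_l; [pose proof (cond_pos eps)|]; lra. }
split; intros eps; destruct (K eps) as [d Hd]; exists d; intros u v Hu Hv;
 specialize (Hd u v Hu Hv); (eapply Rle_trans; [|exact Hd]).
- refine (Rle_trans _ _ _ _ (re_le_Cmod _)); right; f_equal.
  destruct l, (f (u, v)), (f (x, y)); simpl; ring.
- refine (Rle_trans _ _ _ _ (im_le_Cmod _)); right; f_equal.
  destruct l, (f (u, v)), (f (x, y)); simpl; ring.
Qed.

Lemma differentiable_pt_lim_mul x y :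
  differentiable_pt_lim (fun u v => u * v) x y y x.
Proof.
intros eps; exists eps; intros u v Hu Hv.
replace (u * v - x * y - (y * (u - x) + x * (v - y))) with ((u - x) * (v - y)) by ring.
rewrite Rabs_mult; apply Rmult_le_compat; try apply Rabs_pos; try lra.
apply Rmax_r.
Qed.

Lemma differentiable_pt_lim_snd f x y l :
  derivable_pt_lim f y l -> differentiable_pt_lim (fun _ v => f v) x y 0 l.
Proof.
intros H eps.
destruct (H eps (cond_pos eps)) as [d Hd]; exists d; intros u v Hu Hv.
destruct (Req_dec v y) as [->|N].
- replace (f y - f y - (0 * (u - x) + l * (y - y))) with 0 by ring.
  rewrite Rabs_R0; apply Rmult_le_pos; [left; apply eps|].
  eapply Rle_trans; [apply Rabs_pos|apply Rmax_l].
- assert (N' : v - y <> 0) by lra.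
  specialize (Hd (v - y) N' Hv); replace (y + (v - y)) with v in Hd by ring.
  replace (f v - f y - (0 * (u - x) + l * (v - y))) with
    (((f v - f y) / (v - y) - l) * (v - y)) by (field; auto).
  rewrite Rabs_mult; apply Rmult_le_compat; try apply Rabs_pos; try lra.
  apply Rmax_r.
Qed.

Lemma differentiable_pt_lim_exp_mul f s t l :
  derivable_pt_lim f t l ->
  differentiable_pt_lim (fun s t => exp s * f t) s t (exp s * f t) (exp s * l).
Proof.
intros H.
replace (exp s * f t) with (f t * exp s + exp s * 0) by ring.
replace (exp s * l) with (f t * 0 + exp s * l) by ring.
apply (differentiable_pt_lim_comp (fun u v => u * v) (fun s _ => exp s) (fun _ t => f t)).
- apply differentiable_pt_lim_mul.
- apply differentiable_pt_lim_proj1_0, derivable_pt_lim_exp.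
- now apply differentiable_pt_lim_snd.
Qed.

Definition polar (s t : R) : C := (exp s * cos t, exp s * sin t).

Lemma Cmod_polar s t : Cmod (polar s t) = exp s.
Proof.
unfold Cmod, polar; simpl fst; simpl snd.
replace ((exp s * cos t) ^ 2 + (exp s * sin t) ^ 2)
  with (exp s ^ 2 * ((sin t)² + (cos t)²)) by (unfold Rsqr; ring).
rewrite sin2_cos2, Rmult_1_r; apply sqrt_pow2; left; apply exp_pos.
Qed.

(** In the coordinates [z = e^(s + i t)] the form [H dz / (i z)] has real part
    [Im H ds + Re H dt], and it is closed by the Cauchy-Riemann equations. *)
Lemma polar_closed_form (H : C -> C) s t l :
  cderiv H (polar s t) l ->
  closed_form_at (fun s t => Im (H (polar s t))) (fun s t => Re (H (polar s t))) s t.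
Proof.
intros D; apply cderiv_cauchy_riemann in D; destruct D as [D1 D2].
assert (X := differentiable_pt_lim_exp_mul cos s t _ (derivable_pt_lim_cos t)).
assert (Y := differentiable_pt_lim_exp_mul sin s t _ (derivable_pt_lim_sin t)).
assert (E1 := differentiable_pt_lim_comp _ _ _ _ _ _ _ _ _ _ _ D1 X Y).
assert (E2 := differentiable_pt_lim_comp _ _ _ _ _ _ _ _ _ _ _ D2 X Y).
eexists; eexists; eexists; split; [exact E2|].
match type of E1 with differentiable_pt_lim _ _ _ ?a ?b =>
 match goal with |- differentiable_pt_lim _ _ _ ?c _ => replace c with a by ring end end.
exact E1.
Qed.

(** The mean of [Re H] over the circle of radius [e^s] does not depend on [s]:
    over the rectangle between two values of [s] and [0 <= t <= 2 pi] the sides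
    [t = 0] and [t = 2 pi] cancel by periodicity.  Letting the inner circle
    shrink to the origin, the mean tends to [Re L].  Asking only for a
    limit at the origin lets [H] be built from quotients by powers of [z]. *)
Lemma Re_at_centre_le (H : C -> C) (L : C) (r M : R) :
  0 < r < 1 ->
  (forall z, 0 < Cmod z < 1 -> exists l, cderiv H z l) ->
  (forall eps, 0 < eps -> exists d, 0 < d /\
     forall z, 0 < Cmod z < d -> Cmod (H z - L) <= eps) ->
  (forall z, Cmod z = r -> Re (H z) <= M) ->
  Re L <= M.
Proof.
intros Hr HD HL HM; apply le_epsilon; intros eps Heps.
destruct (HL eps Heps) as (d & Hd & Hlim).
set (rho := Rmin (d / 2) r).
assert (rho0 : 0 < rho) by (apply Rmin_glb_lt; lra).
assert (rhor : rho <= r) by apply Rmin_r.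
assert (rhod : rho <= d / 2) by apply Rmin_l.
set (U := fun s t => Re (H (polar s t))); set (V := fun s t => Im (H (polar s t))).
assert (Hs : ln rho <= ln r).
{ destruct (Req_dec rho r) as [->|]; [lra|left; apply ln_increasing; lra]. }
assert (P2 : 0 < 2 * PI) by (pose proof PI_RGT_0; lra).
assert (CF : closed_form_on V U (ln rho) (ln r) 0 (2 * PI)).
{ intros s t Hs' Ht.
  destruct (HD (polar s t)) as [l Hl]; [|exact (polar_closed_form H s t l Hl)].
  rewrite Cmod_polar; split; [apply exp_pos|].
  apply Rle_lt_trans with r; [|lra].
  rewrite <- (exp_ln r) by lra; destruct (Req_dec s (ln r)) as [->|]; [lra|].
  left; apply exp_increasing; lra. }
assert (B := boundary_integral_closed_form V U _ _ _ _ Hs (Rlt_le _ _ P2) CF).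
unfold boundary_integral in B.
rewrite (RInt_ext (V := R_CompleteNormedModule) (fun x => V x (2 * PI)) (fun x => V x 0)) in B.
2: { intros x _; unfold V, polar; rewrite cos_2PI, sin_2PI, cos_0, sin_0; reflexivity. }
assert (I1 : ex_RInt (fun y => U (ln r) y) 0 (2 * PI))
  by (eapply closed_form_ex_RInt_y; eauto; lra).
assert (I0 : ex_RInt (fun y => U (ln rho) y) 0 (2 * PI))
  by (eapply closed_form_ex_RInt_y; eauto; lra).
assert (B1 : RInt (fun y => U (ln r) y) 0 (2 * PI) <= 2 * PI * M).
{ replace (2 * PI * M) with (RInt (fun _ => M) 0 (2 * PI)).
  2: { rewrite RInt_const; unfold scal; simpl; unfold mult; simpl; ring. }
  apply RInt_le; auto; [lra|apply ex_RInt_const|].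
  intros t _; apply HM; rewrite Cmod_polar, exp_ln; lra. }
assert (B0 : 2 * PI * (Re L - eps) <= RInt (fun y => U (ln rho) y) 0 (2 * PI)).
{ replace (2 * PI * (Re L - eps)) with (RInt (fun _ => Re L - eps) 0 (2 * PI)).
  2: { rewrite RInt_const; unfold scal; simpl; unfold mult; simpl; ring. }
  apply RInt_le; auto; [lra|apply ex_RInt_const|].
  intros t _; unfold U.
  assert (E : Rabs (Re (H (polar (ln rho) t) - L)) <= eps).
  { eapply Rle_trans; [apply re_le_Cmod|].
    apply Hlim; rewrite Cmod_polar, exp_ln; lra. }
  apply Rabs_le_between in E; destruct (H (polar (ln rho) t)), L; simpl in *; lra. }
nra.
Qed.

(** * Rules for complex derivatives *)

Lemma is_derive_cderiv (f : C -> C) (z l : C) :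
  @is_derive C_AbsRing C_NormedModule f z l <-> cderiv f z l.
Proof.
split.
- intros [_ H] eps Heps.
  destruct (H z (fun P HP => HP) (mkposreal eps Heps)) as [d Hd].
  exists d; split; [apply d|]; intros w Hw.
  specialize (Hd w Hw); simpl in Hd.
  unfold minus, plus, opp, scal in Hd; simpl in Hd; unfold mult in Hd; simpl in Hd.
  replace (f w - f z - l * (w - z))%C with (f w - f z - (w - z) * l)%C by ring.
  exact Hd.
- intros H; split.
  + apply is_linear_scal_l.
  + intros x Hx eps.
    assert (E : z = x).
    { apply (is_filter_lim_locally_unique (V := AbsRing_NormedModule C_AbsRing)); exact Hx. }
    subst x.
    destruct (H eps (cond_pos eps)) as (d & Hd & Hf).
    exists (mkposreal d Hd); intros w Hw; simpl.
    unfold minus, plus, opp, scal; simpl; unfold mult; simpl.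
    replace (f w + - f z + - ((w + - z) * l))%C with (f w - f z - l * (w - z))%C by ring.
    exact (Hf w Hw).
Qed.

(** The generic product and chain rules see [C] as the module of the ring over
    itself. *)
Lemma is_derive_cderiv_ring (f : C -> C) (z l : C) :
  @is_derive C_AbsRing (AbsRing_NormedModule C_AbsRing) f z l <-> cderiv f z l.
Proof.
rewrite <- is_derive_cderiv.
split; intros [_ H]; (split; [apply is_linear_scal_l | exact H]).
Qed.

Lemma cderiv_plus f g z l m :
  cderiv f z l -> cderiv g z m -> cderiv (fun w => f w + g w)%C z (l + m)%C.
Proof.
rewrite <- !is_derive_cderiv; intros Hf Hg.
exact (is_derive_plus f g z l m Hf Hg).
Qed.

Lemma cderiv_mult f g z l m :
  cderiv f z l -> cderiv g z m ->
  cderiv (fun w => f w * g w)%C z (l * g z + f z * m)%C.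
Proof.
rewrite <- !is_derive_cderiv_ring; intros Hf Hg.
exact (is_derive_mult (K := C_AbsRing) f g z l m Hf Hg Cmult_comm).
Qed.

Lemma cderiv_comp f g z l m :
  cderiv f (g z) l -> cderiv g z m -> cderiv (fun w => f (g w)) z (l * m)%C.
Proof.
intros Hf Hg; apply is_derive_cderiv_ring in Hg.
rewrite <- is_derive_cderiv in *.
rewrite Cmult_comm.
exact (is_derive_comp (K := C_AbsRing) (V := C_NormedModule) f g z l m Hf Hg).
Qed.

Lemma cderiv_const c z : cderiv (fun _ => c) z 0.
Proof. rewrite <- is_derive_cderiv; exact (is_derive_const (K := C_AbsRing) (V := C_NormedModule) c z). Qed.

Lemma cderiv_id z : cderiv (fun w => w) z 1.
Proof. rewrite <- is_derive_cderiv_ring; exact (is_derive_id (K := C_AbsRing) z). Qed.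

Lemma cderiv_opp f z l : cderiv f z l -> cderiv (fun w => - f w)%C z (- l)%C.
Proof. rewrite <- !is_derive_cderiv; intros Hf; exact (is_derive_opp f z l Hf). Qed.

Lemma cderiv_minus f g z l m :
  cderiv f z l -> cderiv g z m -> cderiv (fun w => f w - g w)%C z (l - m)%C.
Proof. intros Hf Hg; apply cderiv_plus; auto; now apply cderiv_opp. Qed.

Lemma cderiv_ext_near f g z l d : 0 < d ->
  (forall w, Cmod (w - z) < d -> f w = g w) -> cderiv f z l -> cderiv g z l.
Proof.
intros Hd H Hf eps Heps; destruct (Hf eps Heps) as (e & He & Hw).
exists (Rmin d e); split; [now apply Rmin_glb_lt|]; intros w Hwd.
pose proof (Rmin_l d e); pose proof (Rmin_r d e).
rewrite <- (H w), <- (H z); [apply Hw; lra| |lra].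
replace (z - z)%C with (0 : C) by ring; rewrite Cmod_0; auto.
Qed.

Lemma cderiv_C_derive f z l : cderiv f z l -> C_derive f z = l.
Proof. intros H; apply is_C_derive_unique; now apply is_derive_cderiv. Qed.

Lemma cderiv_unique f z l m : cderiv f z l -> cderiv f z m -> l = m.
Proof. intros H1 H2; now rewrite <- (cderiv_C_derive f z l), <- (cderiv_C_derive f z m). Qed.

Lemma Cmod_sub_ge (z w : C) : Cmod z - Cmod w <= Cmod (z - w).
Proof.
pose proof (Cmod_triangle (z - w) w) as H; replace (z - w + w)%C with z in H by ring; lra.
Qed.

Lemma RtoC_neq_0 (x : R) : x <> 0 -> RtoC x <> 0.
Proof. intros N E; injection E; exact N. Qed.

Lemma Cmod_lt_of_near (u w : C) (r : R) : Cmod (u - w) < r - Cmod w -> Cmod u < r.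
Proof.
intros H; replace u with ((u - w) + w)%C by ring.
eapply Rle_lt_trans; [apply Cmod_triangle|]; lra.
Qed.

Lemma cderiv_inv (z : C) : z <> 0 -> cderiv (fun w => / w)%C z (- / (z * z))%C.
Proof.
intros Hz eps Heps.
assert (P : 0 < Cmod z) by now apply Cmod_gt_0.
set (m := Cmod z) in *.
exists (Rmin (m / 2) (eps * (m * m * m) / 2)); split.
{ apply Rmin_glb_lt; [lra|]. apply Rdiv_lt_0_compat; [|lra].
  repeat apply Rmult_lt_0_compat; auto. }
intros w Hw; set (h := Cmod (w - z)) in *.
pose proof (Rmin_l (m / 2) (eps * (m * m * m) / 2)).
pose proof (Rmin_r (m / 2) (eps * (m * m * m) / 2)).
assert (Hm : m / 2 <= Cmod w).
{ pose proof (Cmod_sub_ge z w) as B.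
  replace (z - w)%C with (- (w - z))%C in B by ring; rewrite Cmod_opp in B.
  fold m h in B; lra. }
assert (Hw0 : w <> 0) by (intros ->; rewrite Cmod_0 in Hm; lra).
replace (/ w - / z - - / (z * z) * (w - z))%C with ((w - z) * (w - z) / (z * z * w))%C
  by (field; auto).
rewrite Cmod_div, !Cmod_mult by (repeat apply Cmult_neq_0; auto).
fold h m; pose proof (Cmod_ge_0 (w - z)) as h0; fold h in h0.
apply Rmult_le_reg_r with (m * m * Cmod w).
{ repeat apply Rmult_lt_0_compat; lra. }
unfold Rdiv; rewrite Rmult_assoc, Rinv_l, Rmult_1_r.
2: { apply Rgt_not_eq; repeat apply Rmult_lt_0_compat; lra. }
replace (eps * h * (m * m * Cmod w)) with (h * (eps * (m * m * Cmod w))) by ring.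
apply Rmult_le_compat_l; auto.
apply Rle_trans with (eps * (m * m * (m / 2))); [|].
- replace (eps * (m * m * (m / 2))) with (eps * (m * m * m) / 2) by field; lra.
- repeat apply Rmult_le_compat_l; try lra; nra.
Qed.

Definition cdiff (f : C -> C) (z : C) : Prop := exists l, cderiv f z l.

Lemma cdiff_plus f g z : cdiff f z -> cdiff g z -> cdiff (fun w => f w + g w)%C z.
Proof. intros [l Hl] [m Hm]; eexists; eapply cderiv_plus; eauto. Qed.
Lemma cdiff_minus f g z : cdiff f z -> cdiff g z -> cdiff (fun w => f w - g w)%C z.
Proof. intros [l Hl] [m Hm]; eexists; eapply cderiv_minus; eauto. Qed.
Lemma cdiff_mult f g z : cdiff f z -> cdiff g z -> cdiff (fun w => f w * g w)%C z.
Proof. intros [l Hl] [m Hm]; eexists; eapply cderiv_mult; eauto. Qed.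
Lemma cdiff_const c z : cdiff (fun _ => c) z.
Proof. eexists; apply cderiv_const. Qed.
Lemma cdiff_id z : cdiff (fun w => w) z.
Proof. eexists; apply cderiv_id. Qed.
Lemma cdiff_inv (z : C) : z <> 0 -> cdiff (fun w => / w)%C z.
Proof. eexists; apply cderiv_inv; auto. Qed.

Lemma analytic_cdiff f : analytic f -> forall z, Cmod z < 1 -> cdiff f z.
Proof. intros H z Hz; destruct (H z Hz) as [l Hl]; exists l; now apply is_derive_cderiv. Qed.

(** * Orders of vanishing at the origin *)

Definition bigO (k : nat) (u : C -> C) : Prop :=
  exists K d, 0 <= K /\ 0 < d /\ forall z, Cmod z < d -> Cmod (u z) <= K * Cmod z ^ k.

Lemma bigO_ext_near k u v d : 0 < d ->
  (forall z, Cmod z < d -> u z = v z) -> bigO k u -> bigO k v.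
Proof.
intros Hd E (K & e & HK & He & H).
exists K, (Rmin d e); repeat split; auto; [now apply Rmin_glb_lt|].
intros z Hz; pose proof (Rmin_l d e); pose proof (Rmin_r d e).
rewrite <- E by lra; apply H; lra.
Qed.

Lemma bigO_ext k u v : (forall z, u z = v z) -> bigO k u -> bigO k v.
Proof. intros E; apply (bigO_ext_near k u v 1); auto; lra. Qed.

Lemma bigO_plus k u v : bigO k u -> bigO k v -> bigO k (fun z => u z + v z)%C.
Proof.
intros (K & d & HK & Hd & H) (L & e & HL & He & H').
exists (K + L), (Rmin d e); repeat split; [lra|now apply Rmin_glb_lt|].
intros z Hz; pose proof (Rmin_l d e); pose proof (Rmin_r d e).
eapply Rle_trans; [apply Cmod_triangle|].
specialize (H z ltac:(lra)); specialize (H' z ltac:(lra)); lra.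
Qed.

Lemma bigO_opp k u : bigO k u -> bigO k (fun z => - u z)%C.
Proof.
intros (K & d & HK & Hd & H); exists K, d; repeat split; auto.
intros z Hz; rewrite Cmod_opp; auto.
Qed.

Lemma bigO_mult k m u v : bigO k u -> bigO m v -> bigO (k + m) (fun z => u z * v z)%C.
Proof.
intros (K & d & HK & Hd & H) (L & e & HL & He & H').
exists (K * L), (Rmin d e); repeat split; [nra|now apply Rmin_glb_lt|].
intros z Hz; pose proof (Rmin_l d e); pose proof (Rmin_r d e).
rewrite Cmod_mult, pow_add.
replace (K * L * (Cmod z ^ k * Cmod z ^ m)) with (K * Cmod z ^ k * (L * Cmod z ^ m)) by ring.
apply Rmult_le_compat; try apply Cmod_ge_0; [apply H|apply H']; lra.
Qed.

Lemma bigO_weaken k m u : (m <= k)%nat -> bigO k u -> bigO m u.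
Proof.
intros L (K & d & HK & Hd & H).
exists K, (Rmin d 1); repeat split; auto; [apply Rmin_glb_lt; lra|].
intros z Hz; pose proof (Rmin_l d 1); pose proof (Rmin_r d 1).
eapply Rle_trans; [apply H; lra|]; apply Rmult_le_compat_l; auto.
replace k with (m + (k - m))%nat by lia; rewrite pow_add.
pose proof (Cmod_ge_0 z).
rewrite <- (Rmult_1_r (Cmod z ^ m)) at 2; apply Rmult_le_compat_l; [apply pow_le; auto|].
rewrite <- (pow1 (k - m)); apply pow_incr; lra.
Qed.

Lemma bigO_const c : bigO 0 (fun _ => c).
Proof.
exists (Cmod c), 1; repeat split; [apply Cmod_ge_0|lra|]; intros; simpl; lra.
Qed.

Lemma bigO_id : bigO 1 (fun z => z).
Proof. exists 1, 1; repeat split; try lra; intros; simpl; lra. Qed.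

Lemma bigO_scal k c u : bigO k u -> bigO k (fun z => c * u z)%C.
Proof. apply (bigO_mult 0 k (fun _ => c) u (bigO_const c)). Qed.

Lemma bigO_comp k u v : bigO k u -> bigO 1 v -> bigO k (fun z => u (v z)).
Proof.
intros (K & d & HK & Hd & H) (L & e & HL & He & H').
assert (P : 0 < d / (L + 1)) by (apply Rdiv_lt_0_compat; lra).
exists (K * L ^ k), (Rmin e (d / (L + 1))).
repeat split; [apply Rmult_le_pos; auto; apply pow_le; auto|now apply Rmin_glb_lt|].
intros z Hz; pose proof (Rmin_l e (d / (L + 1))); pose proof (Rmin_r e (d / (L + 1))).
pose proof (Cmod_ge_0 z).
assert (B : Cmod (v z) <= L * Cmod z) by (specialize (H' z ltac:(lra)); simpl in H'; lra).
assert (Cmod (v z) < d).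
{ assert (Cmod z * (L + 1) < d); [|nra].
  replace d with (d / (L + 1) * (L + 1)) by (field; lra).
  apply Rmult_lt_compat_r; lra. }
eapply Rle_trans; [apply H; auto|].
rewrite Rmult_assoc, <- Rpow_mult_distr; apply Rmult_le_compat_l; auto.
apply pow_incr; split; [apply Cmod_ge_0|auto].
Qed.

Lemma bigO_div k u v (c : C) :
  c <> 0 -> bigO 1 (fun z => v z - c)%C -> bigO k (fun z => u z * v z)%C -> bigO k u.
Proof.
intros Hc (L & e & HL & He & H') (K & d & HK & Hd & H).
assert (P : 0 < Cmod c) by now apply Cmod_gt_0.
assert (Q : 0 < Cmod c / (2 * (L + 1))) by (apply Rdiv_lt_0_compat; lra).
set (q := Cmod c / (2 * (L + 1))) in *.
exists (2 * K / Cmod c), (Rmin (Rmin d e) q).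
repeat split; [apply Rdiv_le_0_compat; lra|repeat apply Rmin_glb_lt; auto|].
intros z Hz; pose proof (Rmin_l (Rmin d e) q); pose proof (Rmin_r (Rmin d e) q).
pose proof (Rmin_l d e); pose proof (Rmin_r d e); pose proof (Cmod_ge_0 z).
specialize (H z ltac:(lra)); specialize (H' z ltac:(lra)).
rewrite Cmod_mult in H; simpl in H'; rewrite Rmult_1_r in H'.
assert (B : Cmod c / 2 <= Cmod (v z)).
{ pose proof (Cmod_sub_ge c (c - v z)) as T; replace (c - (c - v z))%C with (v z) in T by ring.
  replace (c - v z)%C with (- (v z - c))%C in T by ring; rewrite Cmod_opp in T.
  assert (Cmod z * (L + 1) <= Cmod c / 2); [|nra].
  replace (Cmod c / 2) with (q * (L + 1)) by (unfold q; field; lra).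
  apply Rmult_le_compat_r; lra. }
pose proof (Cmod_ge_0 (u z)).
assert (E : Cmod (u z) * (Cmod c / 2) <= K * Cmod z ^ k) by nra.
apply Rmult_le_reg_r with (Cmod c / 2); [lra|].
replace (2 * K / Cmod c * Cmod z ^ k * (Cmod c / 2)) with (K * Cmod z ^ k) by (field; lra).
exact E.
Qed.

(** At the origin the value of the quotient is [u 0 * / 0], which is [0] because
    the hypothesis forces [u 0 = 0]. *)
Lemma bigO_div_id k u : bigO (S k) u -> bigO k (fun z => u z / z)%C.
Proof.
intros (K & d & HK & Hd & H); exists K, d; repeat split; auto; intros z Hz.
specialize (H z Hz).
destruct (Ceq_dec z 0) as [->|N].
- rewrite Cmod_0 in H; simpl in H; rewrite Rmult_0_l, Rmult_0_r in H.
  pose proof (Cmod_ge_0 (u 0)).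
  rewrite (Cmod_eq_0 (u 0)) by lra; unfold Cdiv; rewrite Cmult_0_l, Cmod_0.
  apply Rmult_le_pos; auto; apply pow_le; lra.
- rewrite Cmod_div by auto.
  assert (P : 0 < Cmod z) by now apply Cmod_gt_0.
  apply Rmult_le_reg_r with (Cmod z); auto.
  unfold Rdiv; rewrite Rmult_assoc, Rinv_l, Rmult_1_r by lra.
  simpl in H; lra.
Qed.

(** * The Schwarz-Pick inequality for the second coefficient *)

Definition Cmod2 (z : C) : R := fst z * fst z + snd z * snd z.

Lemma Cmod2_sqr z : Cmod2 z = Cmod z ^ 2.
Proof. rewrite Cmod2_alt; unfold Cmod2, Re, Im; ring. Qed.

(** With [psi = omega / z], of modulus at most [1 / r] on the circle, the first two
    coefficients of [psi (x + y z)] are [m0 = x c1] and [m1 = x c2 + y c1].  The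
    inequality comes from [0 <= |psi (x + y z) - m0 - m1 z|^2], where the square
    [|psi (x + y z)|^2] is at most [|x + y z|^2 / r^2].  On the circle
    [Cconj z = r^2 / z], so what remains is, up to constants, the real part of a
    Laurent expression in [z]; its pole at the origin is removed by
    [Re (k r^2 / z) = Re (Cconj k * z)].  This leaves a function [H] with a limit
    at the origin, to which [Re_at_centre_le] applies. *)
Lemma schwarz_pick_form_at_radius (omega : C -> C) (c1 c2 x y : C) (r : R) :
  0 < r < 1 ->
  (forall z, Cmod z < 1 -> cdiff omega z) ->
  (forall z, Cmod z < 1 -> Cmod (omega z) < 1) ->
  bigO 3 (fun z => omega z - c1 * z - c2 * (z * z))%C ->
  Cmod2 (x * c1) + r ^ 2 * Cmod2 (x * c2 + y * c1) <= (Cmod2 x + r ^ 2 * Cmod2 y) / r ^ 2.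
Proof.
intros Hr Hd H1 HO.
set (q := / r ^ 2); set (m0 := (x * c1)%C); set (m1 := (x * c2 + y * c1)%C).
set (psi := fun z => (omega z * / z)%C).
set (chi := fun z => ((omega z - c1 * z) * (/ z * / z))%C).
set (k := (2 * (Cconj (x * Cconj m1 * c1) - Cconj m0 * m1 - q * (Cconj x * y)))%C).
set (H := fun z => (2 * (psi z * (x + y * z) * Cconj m0 + Cconj m1 * (r ^ 2)%R * (x * chi z + y * psi z)) + k * z)%C).
set (L := (2 * (x * c1 * Cconj m0 + Cconj m1 * (r ^ 2)%R * (x * c2 + y * c1)))%C).
assert (r2 : 0 < r ^ 2) by (apply pow_lt; lra).
assert (M : Re L <= (Cmod2 x + r ^ 2 * Cmod2 y) / r ^ 2 + Cmod2 m0 + r ^ 2 * Cmod2 m1).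
{ apply (Re_at_centre_le H L r); auto.
  - intros z Hz.
    assert (z <> 0) by (apply Cmod_gt_0; lra).
    assert (cdiff omega z) by (apply Hd; lra).
    change (cdiff H z); unfold H, psi, chi.
    repeat (apply cdiff_minus || apply cdiff_plus || apply cdiff_mult ||
            apply cdiff_const || apply cdiff_id || apply cdiff_inv || assumption).
  - assert (B2 : bigO 1 (fun z => (omega z - c1 * z - c2 * (z * z)) / z / z)%C)
      by (apply bigO_div_id, bigO_div_id; exact HO).
    assert (B1 : bigO 1 (fun z => (omega z - c1 * z) / z)%C).
    { apply bigO_div_id.
      apply (bigO_ext _ (fun z => (omega z - c1 * z - c2 * (z * z)) + c2 * (z * z))%C); [intros; ring|].
      apply bigO_plus; [apply (bigO_weaken 3); [lia|exact HO]|].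
      apply bigO_scal; exact (bigO_mult 1 1 _ _ bigO_id bigO_id). }
    set (E := fun z => (2 * (Cconj m0 * ((omega z - c1 * z) / z * (x + y * z)) + (Cconj m0 * c1 * y) * z
       + Cconj m1 * (r ^ 2)%R * (x * ((omega z - c1 * z - c2 * (z * z)) / z / z)
          + y * ((omega z - c1 * z) / z))) + k * z)%C).
    assert (BE : bigO 1 E).
    { unfold E.
      apply bigO_plus; [apply bigO_scal|apply bigO_scal, bigO_id].
      apply bigO_plus; [apply bigO_plus|].
      - apply bigO_scal, (bigO_mult 1 0); auto.
        apply bigO_plus; [apply bigO_const|].
        apply (bigO_weaken 1); [lia|]; apply bigO_scal, bigO_id.
      - apply bigO_scal, bigO_id.
      - apply bigO_scal, bigO_plus; apply bigO_scal; auto. }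
    intros eps Heps.
    destruct BE as (K & d & HK & Hd0 & HE).
    exists (Rmin d (eps / (K + 1))); split.
    { apply Rmin_glb_lt; auto; apply Rdiv_lt_0_compat; lra. }
    intros z [Hz0 Hz].
    pose proof (Rmin_l d (eps / (K + 1))); pose proof (Rmin_r d (eps / (K + 1))).
    assert (Nz : z <> 0) by (apply Cmod_gt_0; auto).
    replace (H z - L)%C with (E z) by (unfold H, L, E, psi, chi; field; auto).
    specialize (HE z ltac:(lra)); simpl in HE; rewrite Rmult_1_r in HE.
    assert (Cmod z * (K + 1) < eps); [|nra].
    replace eps with (eps / (K + 1) * (K + 1)) by (field; lra).
    apply Rmult_lt_compat_r; lra.
  - intros z Hz.
    assert (Nz : z <> 0) by (apply Cmod_gt_0; lra).
    assert (Zr : Cmod2 z = r ^ 2) by (rewrite Cmod2_sqr, Hz; auto).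
    assert (P1 : Cmod2 (psi z) <= / r ^ 2).
    { unfold psi; rewrite Cmod2_sqr, Cmod_mult, Cmod_inv, Hz, Rpow_mult_distr, pow_inv by auto.
      assert (0 < / r ^ 2) by now apply Rinv_0_lt_compat.
      rewrite <- (Rmult_1_l (/ r ^ 2)) at 2.
      apply Rmult_le_compat_r; [lra|].
      specialize (H1 z ltac:(lra)); pose proof (Cmod_ge_0 (omega z)); simpl; nra. }
    assert (Echi : ((r ^ 2)%R * chi z = Cconj z * (psi z - c1))%C).
    { replace (RtoC (r ^ 2)) with (z * Cconj z)%C.
      - unfold chi, psi; field; auto.
      - rewrite <- Zr; unfold Cmod2; destruct z as [z1 z2]; 
        unfold Cmult, Cconj, RtoC; simpl; f_equal; ring. }
    assert (EH : Re (H z) + Cmod2 (psi z * (x + y * z) - (m0 + m1 * z)) =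
       Cmod2 (psi z) * Cmod2 (x + y * z) + Cmod2 m0 + Cmod2 z * Cmod2 m1
         - 2 * q * Re (Cconj x * y * z)).
    { unfold H.
      replace (psi z * (x + y * z) * Cconj m0 + Cconj m1 * (r ^ 2)%R * (x * chi z + y * psi z))%C
       with (psi z * (x + y * z) * Cconj m0 + Cconj m1 * (x * ((r ^ 2)%R * chi z) + (r ^ 2)%R * y * psi z))%C
       by ring.
      rewrite Echi, <- Zr; unfold k.
      clear - q.
      generalize (psi z) q m0 m1; intros p q' n0 n1.
      destruct x, y, c1, z, p, n0, n1; unfold Cmod2, Re; simpl; ring. }
    assert (EX : Cmod2 (x + y * z) = Cmod2 x + Cmod2 z * Cmod2 y + 2 * Re (Cconj x * y * z)).
    { destruct x, y, z; unfold Cmod2, Re; simpl; ring. }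
    assert (0 <= Cmod2 (psi z * (x + y * z) - (m0 + m1 * z))) by (rewrite Cmod2_sqr; apply pow2_ge_0).
    assert (Cmod2 (psi z) * Cmod2 (x + y * z) <= q * Cmod2 (x + y * z)).
    { apply Rmult_le_compat_r; auto; rewrite Cmod2_sqr; apply pow2_ge_0. }
    replace ((Cmod2 x + r ^ 2 * Cmod2 y) / r ^ 2) with (q * (Cmod2 x + r ^ 2 * Cmod2 y))
      by (unfold q, Rdiv; ring).
    rewrite Zr in *; rewrite EX in *; lra. }
assert (EL : Re L = 2 * Cmod2 m0 + 2 * (r ^ 2 * Cmod2 m1)).
{ unfold L; fold m0; fold m1; generalize m0, m1, (r ^ 2); intros n0 n1 t.
  destruct n0, n1; unfold Cmod2, Re; simpl; ring. }
lra.
Qed.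

(** The Schwarz-Pick inequality at second order.  As the radius tends to [1] the
    previous inequality says that the matrix [[c1, 0], [c2, c1]] is a
    contraction, and the bound is read off a well chosen vector [(x, y)]. *)
Lemma schwarz_pick_second_coefficient (omega : C -> C) (c1 c2 : C) :
  (forall z, Cmod z < 1 -> cdiff omega z) ->
  (forall z, Cmod z < 1 -> Cmod (omega z) < 1) ->
  bigO 3 (fun z => omega z - c1 * z - c2 * (z * z))%C ->
  Cmod c2 <= 1 - Cmod c1 ^ 2.
Proof.
intros Hd H1 HO.
assert (F : forall x y, Cmod2 (x * c1) + Cmod2 (x * c2 + y * c1) <= Cmod2 x + Cmod2 y).
{ intros x y; apply le_epsilon; intros eps Heps.
  set (A := Cmod2 (x * c1)); set (B := Cmod2 (x * c2 + y * c1)).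
  set (X := Cmod2 x); set (Y := Cmod2 y).
  assert (pos : forall z, 0 <= Cmod2 z) by (intros; rewrite Cmod2_sqr; apply pow2_ge_0).
  assert (A0 := pos (x * c1)%C : 0 <= A); assert (B0 := pos (x * c2 + y * c1)%C : 0 <= B).
  assert (X0 := pos x : 0 <= X); assert (Y0 := pos y : 0 <= Y).
  set (D := A + 2 * B + 1).
  (* with t = r^2 the inequality at radius r loses at most (1 - t) D *)
  set (t := Rmax (/ 4) (1 - eps / D)).
  assert (Dp : 0 < eps / D) by (apply Rdiv_lt_0_compat; unfold D; lra).
  assert (t4 : / 4 <= t) by apply Rmax_l.
  assert (t1 : 1 - eps / D <= t) by apply Rmax_r.
  assert (tl : t < 1) by (apply Rmax_lub_lt; lra).
  assert (R1 : 0 < sqrt t < 1).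
  { split; [apply sqrt_lt_R0; lra|]; rewrite <- sqrt_1; apply sqrt_lt_1; lra. }
  assert (I := schwarz_pick_form_at_radius omega c1 c2 x y (sqrt t) R1 Hd H1 HO).
  rewrite pow2_sqrt in I by lra; fold A B X Y in I.
  apply Rmult_le_compat_r with (r := t) in I; [|lra].
  unfold Rdiv in I; rewrite Rmult_assoc, Rinv_l, Rmult_1_r in I by lra.
  assert (Q : (1 - t) * D <= eps).
  { assert (0 < D) by (unfold D; lra).
    replace eps with (eps / D * D) by (field; lra).
    apply Rmult_le_compat_r; lra. }
  assert (0 <= (1 - t) * ((1 - t) * B)) by (repeat apply Rmult_le_pos; lra).
  assert (0 <= (1 - t) * Y) by (apply Rmult_le_pos; lra).
  unfold D in Q; lra. }
assert (C1 : Cmod2 c1 <= 1).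
{ specialize (F 0 1).
  replace (Cmod2 (0 * c1)) with 0 in F by (unfold Cmod2; simpl; ring).
  replace (0 * c2 + 1 * c1)%C with c1 in F by ring.
  replace (Cmod2 0) with 0 in F by (unfold Cmod2; simpl; ring).
  replace (Cmod2 1) with 1 in F by (unfold Cmod2; simpl; ring); lra. }
rewrite <- Cmod2_sqr; set (a := Cmod2 c1) in *.
assert (S2 := Cmod2_sqr c2); set (m := Cmod2 c2) in *.
pose proof (Cmod_ge_0 c2) as G0.
assert (F' : forall s : R, s ^ 2 * a + m * (s + a) ^ 2 <= s ^ 2 + m * a).
{ intros s; specialize (F s (c2 * Cconj c1)%C).
  replace (Cmod2 (s * c1)) with (s ^ 2 * a) in F
    by (unfold a; destruct c1; unfold Cmod2; simpl; ring).
  replace (Cmod2 (s * c2 + c2 * Cconj c1 * c1)) with (m * (s + a) ^ 2) in F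
    by (unfold a, m; destruct c1, c2; unfold Cmod2; simpl; ring).
  replace (Cmod2 s) with (s ^ 2) in F by (unfold Cmod2; simpl; ring).
  replace (Cmod2 (c2 * Cconj c1)) with (m * a) in F
    by (unfold a, m; destruct c1, c2; unfold Cmod2; simpl; ring).
  exact F. }
destruct (Req_dec a 1) as [E|N].
- specialize (F' 1); rewrite E in *.
  assert (m <= 0) by lra.
  assert (Cmod c2 <= 0) by nra; lra.
- (* with s in place of x, the best y is c2 (Cconj c1) s / (1 - a) *)
  specialize (F' (1 - a)).
  replace (1 - a + a) with 1 in F' by ring.
  assert (m <= (1 - a) ^ 2) by (apply Rmult_le_reg_r with (1 - a); lra).
  rewrite S2 in H; nra.
Qed.

(** * Complex power series *)

Notation cseries a l := (@is_series C_AbsRing C_NormedModule a l).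
Notation csum a n := (@sum_n C_AbelianMonoid a n).

Lemma cseries_lim (a : nat -> C) (l : C) (eps : R) : 0 < eps -> cseries a l ->
  exists N, forall n, (N <= n)%nat -> Cmod (csum a n - l) < eps.
Proof.
intros Heps H.
assert (Q : locally l (fun y : C => Cmod (y - l) < eps)).
{ apply (locally_le_locally_norm (K := C_AbsRing) (V := C_NormedModule) l).
  exists (mkposreal eps Heps); intros y Hy; exact Hy. }
destruct (H _ Q) as [N HN]; exists N; exact HN.
Qed.

Lemma cseries_unique (a : nat -> C) (l m : C) : cseries a l -> cseries a m -> l = m.
Proof.
exact (filterlim_locally_unique (V := C_NormedModule) (F := eventually) (sum_n a) l m).
Qed.

Lemma cseries_le (a : nat -> C) (c : nat -> R) (l : C) (m : R) :
  cseries a l -> (forall n, Cmod (a n) <= c n) -> is_series c m -> Cmod l <= m.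
Proof.
intros Ha Hc Hm.
assert (c0 : forall n, 0 <= c n) by (intros n; eapply Rle_trans; [apply Cmod_ge_0|apply Hc]).
assert (S1 : forall n, Cmod (csum a n) <= sum_n c n).
{ induction n as [|n IH]; [rewrite !sum_O; apply Hc|].
  rewrite !sum_Sn; eapply Rle_trans; [apply Cmod_triangle|].
  apply Rplus_le_compat; auto. }
assert (S2 : forall n, sum_n c n <= m).
{ intros n; apply (is_lim_seq_incr_compare (sum_n c) m); auto.
  intros k; rewrite sum_Sn; unfold plus; simpl; specialize (c0 (S k)); lra. }
apply le_epsilon; intros eps Heps.
destruct (cseries_lim a l eps Heps Ha) as [N HN]; specialize (HN N (le_n N)).
pose proof (Cmod_sub_ge l (csum a N)) as T.
replace (l - csum a N)%C with (- (csum a N - l))%C in T by ring; rewrite Cmod_opp in T.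
specialize (S1 N); specialize (S2 N); lra.
Qed.

Lemma cseries_terms_bounded (a : nat -> C) (l : C) :
  cseries a l -> exists M, forall n, Cmod (a n) <= M.
Proof.
intros H; destruct (cseries_lim a l 1 Rlt_0_1 H) as [N HN].
assert (T : forall n, (N <= n)%nat -> Cmod (a (S n)) <= 2).
{ intros n Hn.
  replace (a (S n)) with ((csum a (S n) - l) - (csum a n - l))%C.
  - unfold Cminus at 1; eapply Rle_trans; [apply Cmod_triangle|]; rewrite Cmod_opp.
    pose proof (HN n Hn); pose proof (HN (S n) ltac:(lia)); lra.
  - rewrite sum_Sn; unfold plus; simpl; ring. }
assert (F : forall k, exists M, forall n, (n <= k)%nat -> Cmod (a n) <= M).
{ induction k as [|k [M IH]].
  - exists (Cmod (a 0%nat)); intros n Hn; replace n with 0%nat by lia; lra.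
  - exists (Rmax M (Cmod (a (S k)))); intros n Hn.
    destruct (Nat.eq_dec n (S k)) as [->|]; [apply Rmax_r|].
    eapply Rle_trans; [apply IH; lia|apply Rmax_l]. }
destruct (F N) as [M HM]; exists (Rmax M 2); intros n.
destruct (Nat.le_gt_cases n N) as [L|L].
- eapply Rle_trans; [apply HM; auto|apply Rmax_l].
- destruct n as [|n]; [lia|].
  eapply Rle_trans; [apply T; lia|apply Rmax_r].
Qed.

Definition sums_to (b : nat -> C) (F : C -> C) : Prop :=
  forall z, Cmod z < 1 -> cseries (fun n => b n * z ^ n)%C (F z).

Notation modulus b := (fun n : nat => Cmod (b n)).

(** Absolute convergence in the unit disk, expressed by the real series of moduli
    so that the results on the radius of a derived or shifted real power series
    apply. *)
Definition radius_ge_1 (b : nat -> C) : Prop := Rbar_le 1 (CV_radius (modulus b)).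

Lemma sums_to_radius b F : sums_to b F -> radius_ge_1 b.
Proof.
intros H; unfold radius_ge_1.
destruct (CV_radius_bounded (modulus b)) as [U _].
assert (P : forall r, 0 <= r < 1 -> Rbar_le r (CV_radius (modulus b))).
{ intros r Hr; apply U.
  destruct (cseries_terms_bounded _ _ (H r ltac:(rewrite Cmod_R, Rabs_right; lra))) as [M HM].
  exists M; intros n; rewrite Rabs_mult, Rabs_right by (apply Rle_ge, Cmod_ge_0).
  specialize (HM n); rewrite Cmod_mult, Cmod_pow, Cmod_R, RPow_abs in HM; exact HM. }
destruct (CV_radius (modulus b)) as [R| |]; simpl in *; auto.
- apply le_epsilon; intros eps Heps; destruct (Rle_dec 1 eps) as [L|L].
  + specialize (P 0 ltac:(lra)); lra.
  + specialize (P (1 - eps) ltac:(lra)); lra.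
- specialize (P 0 ltac:(lra)); auto.
Qed.

Lemma radius_abs_summable b (r : R) : radius_ge_1 b -> 0 <= r < 1 ->
  ex_series (fun n => Cmod (b n) * r ^ n).
Proof.
intros H Hr.
apply (ex_series_ext (fun n => Rabs (Cmod (b n) * r ^ n))).
- intros n; apply Rabs_right, Rle_ge, Rmult_le_pos; [apply Cmod_ge_0|apply pow_le; lra].
- apply (CV_disk_inside (modulus b)).
  eapply Rbar_lt_le_trans; [|exact H]; simpl; rewrite Rabs_right; lra.
Qed.

Lemma radius_sums b : radius_ge_1 b -> exists F, sums_to b F.
Proof.
intros H.
exists (fun z => epsilon (inhabits (RtoC 0)) (fun l => cseries (fun n => b n * z ^ n)%C l)).
intros z Hz; apply epsilon_spec.
apply (ex_series_le (V := C_CompleteNormedModule) _ (fun n => Cmod (b n) * Cmod z ^ n)).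
- intros n; change (Cmod (b n * z ^ n) <= Cmod (b n) * Cmod z ^ n).
  rewrite Cmod_mult, Cmod_pow; lra.
- apply radius_abs_summable; auto; split; [apply Cmod_ge_0|auto].
Qed.

Definition coef_derive (b : nat -> C) (n : nat) : C := (INR (S n) * b (S n))%C.
Definition coef_shift (b : nat -> C) (n : nat) : C := b (S n).

Lemma radius_derive b : radius_ge_1 b -> radius_ge_1 (coef_derive b).
Proof.
unfold radius_ge_1; rewrite <- (CV_radius_derive (modulus b)).
rewrite (CV_radius_ext (modulus (coef_derive b)) (PS_derive (modulus b))); auto.
intros n; unfold coef_derive, PS_derive; rewrite Cmod_mult, Cmod_R, Rabs_right; auto.
apply Rle_ge, pos_INR.
Qed.

Lemma radius_shift b : radius_ge_1 b -> radius_ge_1 (coef_shift b).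
Proof.
unfold radius_ge_1; rewrite <- (CV_radius_decr_1 (modulus b)); auto.
Qed.

(** Multiplying the remainder by [w] raises the exponent and adds
    [(n + 2) z^(n + 1) (w - z)^2], whence the induction. *)
Lemma power_taylor_bound (z w : C) (r : R) (n : nat) :
  Cmod z <= r -> Cmod w <= r ->
  Cmod (w ^ (n + 2) - z ^ (n + 2) - INR (n + 2) * z ^ (n + 1) * (w - z)) <=
  INR (n + 2) * INR (n + 1) * r ^ n * Cmod (w - z) ^ 2.
Proof.
intros Hz Hw; induction n as [|n IH].
- simpl INR; simpl pow.
  replace (w ^ (0 + 2) - z ^ (0 + 2) - (1 + 1)%R * z ^ (0 + 1) * (w - z))%C with ((w - z) * (w - z))%C.
  + rewrite Cmod_mult; pose proof (Cmod_ge_0 (w - z)); nra.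
  + simpl Nat.add; rewrite RtoC_plus; simpl Cpow; ring.
- set (D := Cmod (w - z)) in *.
  assert (E : (w ^ (S n + 2) - z ^ (S n + 2) - INR (S n + 2) * z ^ (S n + 1) * (w - z) =
     w * (w ^ (n + 2) - z ^ (n + 2) - INR (n + 2) * z ^ (n + 1) * (w - z))
      + INR (n + 2) * z ^ (n + 1) * ((w - z) * (w - z)))%C).
  { replace (S n + 2)%nat with (S (n + 2)) by lia; replace (S n + 1)%nat with (S (n + 1)) by lia.
    rewrite S_INR, RtoC_plus, !Cpow_S.
    replace (n + 2)%nat with (S (n + 1)) by lia; rewrite !Cpow_S; ring. }
  rewrite E; eapply Rle_trans; [apply Cmod_triangle|].
  rewrite !Cmod_mult, Cmod_pow, Cmod_R; fold D.
  rewrite (Rabs_right (INR (n + 2))) by (apply Rle_ge, pos_INR).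
  assert (D0 : 0 <= D) by apply Cmod_ge_0.
  assert (z0 := Cmod_ge_0 z); assert (w0 := Cmod_ge_0 w).
  assert (r0 : 0 <= r) by lra.
  replace (INR (S n + 2)) with (INR (n + 1) + 2).
  2: { rewrite !plus_INR, (S_INR n); change (INR 2) with (1 + 1); change (INR 1) with 1; ring. }
  replace (INR (S n + 1)) with (INR (n + 2)) by (f_equal; lia).
  replace (INR (n + 2)) with (INR (n + 1) + 1) in *.
  2: { rewrite !plus_INR; change (INR 2) with (1 + 1); change (INR 1) with 1; ring. }
  assert (k0 := pos_INR (n + 1)); set (k := INR (n + 1)) in *.
  assert (T1 : Cmod w * Cmod (w ^ (n + 2) - z ^ (n + 2) - (k + 1)%R * z ^ (n + 1) * (w - z)) <=
      r * ((k + 1) * k * r ^ n * D ^ 2)).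
  { apply Rmult_le_compat; auto; apply Cmod_ge_0. }
  assert (T2 : (k + 1) * Cmod z ^ (n + 1) * (D * D) <= (k + 1) * r ^ (n + 1) * (D * D)).
  { apply Rmult_le_compat_r; [nra|]; apply Rmult_le_compat_l; [lra|]; apply pow_incr; auto. }
  assert (0 <= r ^ S n * (D * D) * (k + 1)).
  { apply Rmult_le_pos; [apply Rmult_le_pos; [apply pow_le; auto|nra]|lra]. }
  replace (n + 1)%nat with (S n) in * by lia.
  replace (r * ((k + 1) * k * r ^ n * D ^ 2)) with ((k + 1) * k * (r ^ S n * (D * D))) in T1
    by (simpl; ring).
  replace ((k + 2) * (k + 1) * r ^ S n * D ^ 2) with ((k + 2) * (k + 1) * (r ^ S n * (D * D)))
    by (simpl; ring).
  nra.
Qed.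

(** The remainders [b_n (w^n - z^n - n z^(n - 1) (w - z))] are dominated by
    [|w - z|^2] times the terms of the twice derived series of moduli at the
    intermediate radius [r]. *)
Lemma power_series_cderiv b F F1 z :
  sums_to b F -> sums_to (coef_derive b) F1 -> Cmod z < 1 -> cderiv F z (F1 z).
Proof.
intros HF HF1 Hz eps Heps.
set (r := (1 + Cmod z) / 2).
pose proof (Cmod_ge_0 z) as z0.
assert (Hb := radius_derive _ (radius_derive _ (sums_to_radius _ _ HF))).
destruct (radius_abs_summable _ r Hb) as [K HK]; [unfold r; lra|].
exists (Rmin (r - Cmod z) (eps / (Rabs K + 1))); split.
{ pose proof (Rabs_pos K); apply Rmin_glb_lt; [unfold r; lra|apply Rdiv_lt_0_compat; lra]. }
intros w Hw.
pose proof (Rmin_l (r - Cmod z) (eps / (Rabs K + 1))).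
pose proof (Rmin_r (r - Cmod z) (eps / (Rabs K + 1))).
set (D := Cmod (w - z)) in *.
assert (D0 : 0 <= D) by apply Cmod_ge_0.
assert (Hwr : Cmod w <= r).
{ replace w with ((w - z) + z)%C by ring.
  eapply Rle_trans; [apply Cmod_triangle|]; fold D; lra. }
assert (Hw1 : Cmod w < 1) by (unfold r in *; lra).
(* the series of the remainders, whose first two terms vanish *)
set (e := fun n => (b n * w ^ n - b n * z ^ n
                    - (w - z) * (match n with O => RtoC 0 | S k => (coef_derive b k * z ^ k)%C end))%C).
assert (He : cseries e (F w - F z - (w - z) * F1 z)%C).
{ apply (is_series_minus (V := C_NormedModule)
     (fun n => (b n * w ^ n - b n * z ^ n)%C)
     (fun n => ((w - z) * (match n with O => RtoC 0 | S k => (coef_derive b k * z ^ k)%C end))%C)).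
  - apply (is_series_minus (V := C_NormedModule) (fun n => (b n * w ^ n)%C) (fun n => (b n * z ^ n)%C)); auto.
  - apply (is_series_scal (V := C_NormedModule) (w - z)%C
       (fun n => match n with O => RtoC 0 | S k => (coef_derive b k * z ^ k)%C end)).
    apply is_series_decr_1.
    replace (plus (F1 z) (opp _)) with (F1 z); [apply HF1; auto|].
    unfold plus, opp; simpl; ring. }
assert (He2 : cseries (fun n => e (2 + n)%nat) (F w - F z - (w - z) * F1 z)%C).
{ apply (is_series_incr_n e 2); [lia|].
  replace (plus _ _) with (F w - F z - (w - z) * F1 z)%C; auto.
  simpl Init.Nat.pred; rewrite sum_Sn, sum_O.
  change (F w - F z - (w - z) * F1 z = F w - F z - (w - z) * F1 z + (e 0%nat + e 1%nat))%C.
  unfold e, coef_derive; simpl INR; simpl Cpow; ring. }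
replace (F w - F z - F1 z * (w - z))%C with (F w - F z - (w - z) * F1 z)%C by ring.
assert (B : Cmod (F w - F z - (w - z) * F1 z) <= K * D ^ 2).
{ apply (cseries_le _ (fun n => Cmod (coef_derive (coef_derive b) n) * r ^ n * D ^ 2) _ _ He2).
  - intros n.
    replace (e (2 + n)%nat) with (b (2 + n)%nat *
      (w ^ (n + 2) - z ^ (n + 2) - INR (n + 2) * z ^ (n + 1) * (w - z)))%C.
    2: { replace (n + 2)%nat with (S (S n)) by lia; replace (n + 1)%nat with (S n) by lia.
         change (2 + n)%nat with (S (S n)); unfold e, coef_derive; ring. }
    unfold coef_derive; rewrite !Cmod_mult, !Cmod_R.
    rewrite !(Rabs_right (INR _)) by apply Rle_ge, pos_INR.
    replace (INR (S n) * (INR (S (S n)) * Cmod (b (S (S n)))) * r ^ n * D ^ 2)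
      with (Cmod (b (S (S n))) * (INR (n + 2) * INR (n + 1) * r ^ n * D ^ 2)).
    2: { replace (n + 2)%nat with (S (S n)) by lia; replace (n + 1)%nat with (S n) by lia; ring. }
    apply Rmult_le_compat_l; [apply Cmod_ge_0|].
    apply power_taylor_bound; auto; unfold r; lra.
  - exact (is_series_scal_r (D ^ 2) _ K HK). }
eapply Rle_trans; [exact B|].
pose proof (Rle_abs K); pose proof (Rabs_pos K).
assert (D * (Rabs K + 1) < eps).
{ replace eps with (eps / (Rabs K + 1) * (Rabs K + 1)) by (field; lra).
  apply Rmult_lt_compat_r; lra. }
simpl; rewrite Rmult_1_r, <- Rmult_assoc; apply Rmult_le_compat_r; nra.
Qed.

Lemma power_series_shift b F : sums_to b F ->
  exists T, sums_to (coef_shift b) T /\ forall z, Cmod z < 1 -> F z = (b 0%nat + z * T z)%C.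
Proof.
intros H.
destruct (radius_sums _ (radius_shift _ (sums_to_radius _ _ H))) as [T HT].
exists T; split; auto; intros z Hz.
apply (cseries_unique (fun n => b n * z ^ n)%C); auto.
assert (A : cseries (fun n => b (S n) * z ^ S n)%C (z * T z)%C).
{ apply (is_series_ext (fun n => scal z (coef_shift b n * z ^ n)%C)).
  - intros n; change (z * (b (S n) * z ^ n) = b (S n) * (z * z ^ n))%C; ring.
  - exact (is_series_scal (V := C_NormedModule) z (fun n => coef_shift b n * z ^ n)%C _ (HT z Hz)). }
apply is_series_decr_1.
match goal with |- is_series _ ?l => replace l with (z * T z)%C; [exact A|] end.
change (z * T z = b 0%nat + z * T z + - (b 0%nat * 1))%C; ring.
Qed.

Lemma power_series_bounded b F : sums_to b F -> bigO 0 F.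
Proof.
intros H.
destruct (radius_sums _ (radius_derive _ (sums_to_radius _ _ H))) as [F1 H1].
assert (D := power_series_cderiv b F F1 0 H H1 ltac:(rewrite Cmod_0; lra)).
destruct (D 1 Rlt_0_1) as (d & Hd & Hb).
exists (Cmod (F 0) + (1 + Cmod (F1 0))), (Rmin d 1).
pose proof (Cmod_ge_0 (F 0)); pose proof (Cmod_ge_0 (F1 0)).
repeat split; [lra|apply Rmin_glb_lt; lra|]; intros z Hz.
pose proof (Rmin_l d 1); pose proof (Rmin_r d 1).
replace (z : C) with (z - 0)%C in Hz by ring.
specialize (Hb z ltac:(lra)).
replace (F z) with (F 0 + ((F z - F 0 - F1 0 * (z - 0)) + F1 0 * (z - 0)))%C by ring.
eapply Rle_trans; [apply Cmod_triangle|].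
pose proof (Cmod_triangle (F z - F 0 - F1 0 * (z - 0)) (F1 0 * (z - 0))) as T.
rewrite Cmod_mult in T; simpl pow.
pose proof (Cmod_ge_0 (z - 0)); nra.
Qed.

Lemma power_series_expansion_2 b F : sums_to b F ->
  bigO 2 (fun z => F z - (b 0%nat + b 1%nat * z))%C.
Proof.
intros H.
destruct (power_series_shift _ _ H) as (T1 & H1 & E1).
destruct (power_series_shift _ _ H1) as (T2 & H2 & E2).
apply (bigO_ext_near _ (fun z => z * z * T2 z)%C _ 1 Rlt_0_1).
- intros z Hz; rewrite E1, E2 by auto; unfold coef_shift; ring.
- exact (bigO_mult 2 0 _ _ (bigO_mult 1 1 _ _ bigO_id bigO_id) (power_series_bounded _ _ H2)).
Qed.

Lemma power_series_expansion_3 b F : sums_to b F ->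
  bigO 3 (fun z => F z - (b 0%nat + b 1%nat * z + b 2%nat * (z * z)))%C.
Proof.
intros H.
destruct (power_series_shift _ _ H) as (T1 & H1 & E1).
apply (bigO_ext_near _ (fun z => z * (T1 z - (coef_shift b 0 + coef_shift b 1 * z)))%C _ 1 Rlt_0_1).
- intros z Hz; rewrite E1 by auto; unfold coef_shift; ring.
- exact (bigO_mult 1 2 _ _ bigO_id (power_series_expansion_2 _ _ H1)).
Qed.

Lemma power_series_expansion_4 b F : sums_to b F ->
  bigO 4 (fun z => F z - (b 0%nat + b 1%nat * z + b 2%nat * (z * z) + b 3%nat * (z * z * z)))%C.
Proof.
intros H.
destruct (power_series_shift _ _ H) as (T1 & H1 & E1).
apply (bigO_ext_near _ (fun z => z * (T1 z - (coef_shift b 0 + coef_shift b 1 * z + coef_shift b 2 * (z * z))))%C _ 1 Rlt_0_1).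
- intros z Hz; rewrite E1 by auto; unfold coef_shift; ring.
- exact (bigO_mult 1 3 _ _ bigO_id (power_series_expansion_3 _ _ H1)).
Qed.

(** * Expansions of a function and of its inverse *)

Lemma bigO_plus_min m n u v : bigO m u -> bigO n v -> bigO (Nat.min m n) (fun z => u z + v z)%C.
Proof.
intros Hu Hv; apply bigO_plus; [apply (bigO_weaken m)|apply (bigO_weaken n)]; auto; lia.
Qed.

Lemma bigO_minus_min m n u v : bigO m u -> bigO n v -> bigO (Nat.min m n) (fun z => u z - v z)%C.
Proof. intros Hu Hv; apply bigO_plus_min; auto; now apply bigO_opp. Qed.

(** The order of an expression is computed from those of its atoms, which are
    read from the context; [bigO_calc] then compares it with the claimed order. *)
Ltac bigO_order :=
  first [ apply bigO_const | apply bigO_id | eassumption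
        | apply bigO_mult; [bigO_order | bigO_order]
        | apply bigO_minus_min; [bigO_order | bigO_order]
        | apply bigO_plus_min; [bigO_order | bigO_order]
        | apply bigO_opp; bigO_order ].

Ltac bigO_calc := eapply bigO_weaken; cycle 1; [bigO_order | simpl; lia].

Lemma bigO_near_nonzero (v : C -> C) (c : C) : c <> 0 -> bigO 1 (fun z => v z - c)%C ->
  exists d, 0 < d /\ forall z, Cmod z < d -> v z <> 0.
Proof.
intros Hc (K & d & HK & Hd & H).
assert (P : 0 < Cmod c) by now apply Cmod_gt_0.
exists (Rmin d (Cmod c / (K + 1))); split.
{ apply Rmin_glb_lt; auto; apply Rdiv_lt_0_compat; lra. }
intros z Hz E; pose proof (Rmin_l d (Cmod c / (K + 1))); pose proof (Rmin_r d (Cmod c / (K + 1))).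
specialize (H z ltac:(lra)); rewrite E in H.
replace (0 - c)%C with (- c)%C in H by ring; rewrite Cmod_opp in H; simpl in H.
assert (Cmod z * (K + 1) < Cmod c); [|pose proof (Cmod_ge_0 z); nra].
replace (Cmod c) with (Cmod c / (K + 1) * (K + 1)) by (field; lra).
apply Rmult_lt_compat_r; lra.
Qed.

Lemma bigO_at_0 k u : bigO (S k) u -> u 0 = 0.
Proof.
intros (K & d & HK & Hd & H); specialize (H 0 ltac:(rewrite Cmod_0; auto)).
rewrite Cmod_0 in H; simpl in H; rewrite Rmult_0_l, Rmult_0_r in H.
apply Cmod_eq_0; pose proof (Cmod_ge_0 (u 0)); lra.
Qed.

Lemma cdiff_bigO_1 f : cdiff f 0 -> f 0 = 0 -> bigO 1 f.
Proof.
intros [l Hl] H0; destruct (Hl 1 Rlt_0_1) as (d & Hd & H).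
pose proof (Cmod_ge_0 l).
exists (1 + Cmod l), d; repeat split; auto; [lra|]; intros z Hz.
replace z with (z - 0)%C in Hz by ring; specialize (H z Hz).
rewrite H0 in H; replace (z - 0)%C with z in H by ring.
replace (f z) with ((f z - 0 - l * z) + l * z)%C by ring.
eapply Rle_trans; [apply Cmod_triangle|]; rewrite Cmod_mult; simpl; lra.
Qed.

(** The three expansions are stated separately because an expansion with an error
    term cannot be differentiated. *)
Definition has_jet (f : C -> C) (b2 b3 : C) : Prop :=
  bigO 4 (fun z => f z - (z + b2 * (z * z) + b3 * (z * z * z)))%C /\
  bigO 3 (fun z => C_derive f z - (1 + 2 * b2 * z + 3 * b3 * (z * z)))%C /\
  bigO 2 (fun z => C_derive (C_derive f) z - (2 * b2 + 6 * b3 * z))%C.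

Definition twice_cderiv (f : C -> C) : Prop := forall z, Cmod z < 1 ->
  cderiv f z (C_derive f z) /\ cderiv (C_derive f) z (C_derive (C_derive f) z).

Lemma normalized_expansion_jet a f : normalized_expansion a f ->
  has_jet f (a 2%nat) (a 3%nat) /\ twice_cderiv f.
Proof.
intros H.
set (b := fun n => match n with O => RtoC 0 | 1%nat => RtoC 1 | _ => a n end).
assert (HF : sums_to b f).
{ intros z Hz; apply (is_series_decr_n _ 2); [lia|].
  apply (is_series_ext (fun n => (a (n + 2)%nat * z ^ (n + 2))%C)).
  - intros n; rewrite (Nat.add_comm n 2); reflexivity.
  - replace (plus _ _) with (f z - z)%C; [apply H; auto|].
    simpl Init.Nat.pred; rewrite sum_Sn, sum_O.
    change (f z - z = f z - (b 0%nat * z ^ 0 + b 1%nat * z ^ 1))%C.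
    simpl; ring. }
assert (R0 := sums_to_radius _ _ HF); assert (R1 := radius_derive _ R0).
destruct (radius_sums _ R1) as [F1 H1].
destruct (radius_sums _ (radius_derive _ R1)) as [F2 H2].
assert (D1 : forall z, Cmod z < 1 -> cderiv f z (F1 z)) by (intros; apply (power_series_cderiv b); auto).
assert (D2 : forall z, Cmod z < 1 -> cderiv F1 z (F2 z))
  by (intros; apply (power_series_cderiv (coef_derive b)); auto).
assert (E1 : forall z, Cmod z < 1 -> C_derive f z = F1 z) by (intros; apply cderiv_C_derive; auto).
assert (D2' : forall z, Cmod z < 1 -> cderiv (C_derive f) z (F2 z)).
{ intros z Hz; apply (cderiv_ext_near F1 _ z _ (1 - Cmod z)); [lra| |auto].
  intros w Hw; symmetry; apply E1; exact (Cmod_lt_of_near w z 1 Hw). }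
assert (E2 : forall z, Cmod z < 1 -> C_derive (C_derive f) z = F2 z)
  by (intros; apply cderiv_C_derive; auto).
split.
- split; [|split].
  + refine (bigO_ext _ _ _ _ (power_series_expansion_4 _ _ HF)).
    intros z; unfold b; ring.
  + refine (bigO_ext_near _ _ _ 1 Rlt_0_1 _ (power_series_expansion_3 _ _ H1)).
    intros z Hz; rewrite E1 by auto; unfold coef_derive, b.
    rewrite !S_INR, !RtoC_plus; simpl INR; ring.
  + refine (bigO_ext_near _ _ _ 1 Rlt_0_1 _ (power_series_expansion_2 _ _ H2)).
    intros z Hz; rewrite E2 by auto; unfold coef_derive, b.
    rewrite !S_INR, !RtoC_plus; simpl INR; ring.
- intros z Hz; split; [rewrite E1; auto|rewrite E2; auto].
Qed.

(** The expansion of [g] is found by substituting the identity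
    [w = g + a2 g^2 + a3 g^3 + O(g^4)] into itself, gaining one order each time.
    Its derivatives are not obtained from that expansion but from
    [f'(g) g' = 1] and [g'' f'(g)^3 = - f''(g)], by multiplying the claimed
    differences by a power of [v = f'(g)], which tends to [1]. *)
Lemma inverse_jet f g a2 a3 :
  has_jet f a2 a3 -> twice_cderiv f -> univalent f -> univalent g -> inverse_near_0 f g ->
  has_jet g (- a2)%C (2 * (a2 * a2) - a3)%C.
Proof.
intros (J0 & J1 & J2) HD [_ If] [Ag _] (r & Hr & Hfg).
assert (f0 : f 0 = 0).
{ assert (E := bigO_at_0 _ _ J0); cbv beta in E.
  replace (f 0) with (f 0 - (0 + a2 * (0 * 0) + a3 * (0 * 0 * 0)))%C by ring; exact E. }
assert (g0 : g 0 = 0).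
{ destruct (Hfg 0) as [G1 G2]; [rewrite Cmod_0; auto|].
  apply If; auto; [unfold in_disk; rewrite Cmod_0; lra|rewrite G2; auto]. }
set (rho := Rmin r 1).
assert (rho0 : 0 < rho) by (apply Rmin_glb_lt; lra).
assert (rhor : rho <= r) by apply Rmin_l.
assert (rho1 : rho <= 1) by apply Rmin_r.
assert (Dg : forall w, Cmod w < rho -> cderiv g w (C_derive g w)).
{ intros w Hw; destruct (analytic_cdiff g Ag w) as [l Hl]; [lra|].
  now rewrite (cderiv_C_derive g w l Hl). }
assert (chain : forall w, Cmod w < rho -> (C_derive f (g w) * C_derive g w = 1)%C).
{ intros w Hw; destruct (Hfg w) as [G1 G2]; [lra|].
  apply (cderiv_unique (fun w => w) w); [|apply cderiv_id].
  apply (cderiv_ext_near (fun w => f (g w)) _ w _ (rho - Cmod w)); [lra| |].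
  - intros u Hu; apply Hfg; pose proof (Cmod_lt_of_near u w rho Hu); lra.
  - apply cderiv_comp; [apply HD; auto|apply Dg; auto]. }
assert (chain2 : forall w, Cmod w < rho ->
  (C_derive (C_derive g) w * (C_derive f (g w) * C_derive f (g w) * C_derive f (g w))
   = - C_derive (C_derive f) (g w))%C).
{ intros w Hw; assert (Ch := chain w Hw).
  assert (N : C_derive f (g w) <> 0).
  { intros E; rewrite E, Cmult_0_l in Ch; injection Ch; lra. }
  assert (D : cderiv (C_derive g) w
     (- / (C_derive f (g w) * C_derive f (g w)) * (C_derive (C_derive f) (g w) * C_derive g w))%C).
  { apply (cderiv_ext_near (fun w => / (C_derive f (g w)))%C _ w _ (rho - Cmod w)); [lra| |].
    - intros u Hu.
      assert (Hu' := Cmod_lt_of_near u w rho Hu).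
      assert (Cu := chain u Hu').
      assert (Nu : C_derive f (g u) <> 0).
      { intros E; rewrite E, Cmult_0_l in Cu; injection Cu; lra. }
      replace (/ C_derive f (g u))%C with (/ C_derive f (g u) * (C_derive f (g u) * C_derive g u))%C
        by (rewrite Cu; ring).
      field; auto.
    - apply (cderiv_comp Cinv (fun w => C_derive f (g w))); [apply cderiv_inv; auto|].
      apply cderiv_comp; [apply HD|apply Dg; auto].
      apply Hfg; lra. }
  rewrite (cderiv_C_derive _ _ _ D).
  replace (C_derive g w) with (/ C_derive f (g w))%C; [field; auto|].
  replace (C_derive g w) with (/ C_derive f (g w) * (C_derive f (g w) * C_derive g w))%C
    by (field; auto).
  rewrite Ch; ring. }
assert (Og : bigO 1 g).
{ apply cdiff_bigO_1; auto; apply analytic_cdiff; auto; rewrite Cmod_0; lra. }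
assert (K0 := bigO_comp _ _ _ J0 Og); assert (K1 := bigO_comp _ _ _ J1 Og);
assert (K2 := bigO_comp _ _ _ J2 Og); cbv beta in K0, K1, K2.
set (R0 := fun w => _) in K0; set (R1 := fun w => _) in K1; set (R2 := fun w => _) in K2.
assert (FG : forall w, Cmod w < rho -> R0 w = (w - (g w + a2 * (g w * g w) + a3 * (g w * g w * g w)))%C).
{ intros w Hw; unfold R0; destruct (Hfg w) as [_ ->]; auto; lra. }
(* [R0 w], [R1 w], [R2 w] are the errors of the jet of f at the point g w *)
set (E1 := fun w => (g w - w)%C).
assert (O1 : bigO 2 E1).
{ apply (bigO_ext_near _ (fun w => - (a2 * (g w * g w) + a3 * (g w * g w * g w) + R0 w))%C _ rho rho0).
  - intros w Hw; rewrite FG by auto; unfold E1; ring.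
  - bigO_calc. }
set (E2 := fun w => (g w - w + a2 * (w * w))%C).
assert (O2 : bigO 3 E2).
{ apply (bigO_ext_near _ (fun w => - (a2 * (E1 w * (g w + w)) + a3 * (g w * g w * g w) + R0 w))%C _ rho rho0).
  - intros w Hw; rewrite FG by auto; unfold E1, E2; ring.
  - bigO_calc. }
set (v := fun w => C_derive f (g w)).
set (Q := fun w => (2 * a2 * E2 w + 3 * a3 * (E1 w * (g w + w)) + R1 w)%C).
assert (OQ : bigO 3 Q) by (unfold Q; bigO_calc).
assert (Ev : forall w, v w = (1 + 2 * a2 * w + (3 * a3 - 2 * (a2 * a2)) * (w * w) + Q w)%C).
{ intros w; unfold v, Q, R1, E1, E2; ring. }
assert (Ov : bigO 1 (fun w => v w - 1)%C).
{ apply (bigO_ext _ (fun w => 2 * a2 * w + (3 * a3 - 2 * (a2 * a2)) * (w * w) + Q w)%C).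
  - intros w; rewrite Ev; ring.
  - bigO_calc. }
assert (N1 : RtoC 1 <> 0) by (apply RtoC_neq_0; lra).
split; [|split].
- apply (bigO_ext_near _ (fun w => - (a2 * (2 * w * E2 w + E1 w * E1 w))
     - a3 * (E1 w * (g w * g w + g w * w + w * w)) - R0 w)%C _ rho rho0).
  + intros w Hw; rewrite FG by auto; unfold E1, E2; ring.
  + bigO_calc.
- apply (bigO_div _ _ v 1 N1 Ov).
  set (P := fun w => (1 + 2 * - a2 * w + 3 * (2 * (a2 * a2) - a3) * (w * w))%C).
  apply (bigO_ext_near _ (fun w =>
    - (w * w * w) * ((-2) * a2 * (3 * a3 - 2 * (a2 * a2)) + 3 * (2 * (a2 * a2) - a3) * (2 * a2)
        + w * (3 * (2 * (a2 * a2) - a3) * (3 * a3 - 2 * (a2 * a2))))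
    - (1 + 2 * - a2 * w + 3 * (2 * (a2 * a2) - a3) * (w * w)) * Q w)%C _ rho rho0).
  + intros w Hw.
    replace ((C_derive g w - (1 + 2 * - a2 * w + 3 * (2 * (a2 * a2) - a3) * (w * w))) * v w)%C
     with (v w * C_derive g w - (1 + 2 * - a2 * w + 3 * (2 * (a2 * a2) - a3) * (w * w)) * v w)%C by ring.
    unfold v at 1; rewrite chain, Ev by auto; ring.
  + bigO_calc.
- apply (bigO_div _ _ (fun w => v w * v w * v w)%C 1 N1).
  { apply (bigO_ext _ (fun w => (v w - 1) * (v w * v w + v w + 1))%C); [intros; ring|].
    assert (bigO 0 v).
    { apply (bigO_ext _ (fun w => (v w - 1) + 1)%C); [intros; ring|]; bigO_calc. }
    bigO_calc. }
  set (V1 := fun w => (1 + 2 * a2 * w)%C).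
  set (W := fun w => ((3 * a3 - 2 * (a2 * a2)) * (w * w) + Q w)%C).
  assert (OW : bigO 2 W) by (unfold W; bigO_calc).
  assert (OV : bigO 0 V1) by (unfold V1; bigO_calc).
  assert (Ev' : forall w, v w = (V1 w + W w)%C) by (intros w; rewrite Ev; unfold V1, W; ring).
  set (c := (12 * (a2 * a2) - 6 * a3)%C).
  apply (bigO_ext_near _ (fun w =>
    - (6 * a3 * E1 w + R2 w)
    - (w * w) * (((-2) * a2 * (12 * (a2 * a2)) + c * (6 * a2))
        + w * ((-2) * a2 * (8 * (a2 * a2 * a2)) + c * (12 * (a2 * a2)))
        + w * w * (c * (8 * (a2 * a2 * a2))))
    - ((-2) * a2 + c * w) * (W w * (3 * (V1 w * V1 w) + 3 * (V1 w * W w) + W w * W w)))%C _ rho rho0).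
  + intros w Hw.
    replace ((C_derive (C_derive g) w - (2 * - a2 + 6 * (2 * (a2 * a2) - a3) * w)) * (v w * v w * v w))%C
     with (C_derive (C_derive g) w * (v w * v w * v w)
       - (2 * - a2 + 6 * (2 * (a2 * a2) - a3) * w) * (v w * v w * v w))%C by ring.
    unfold v at 1 2 3; rewrite chain2, Ev' by auto.
    unfold R2, c, E1, V1; ring.
  + bigO_calc.
Qed.

(** * Expansions of the quotient, of the dominant function and of the Schwarz function *)

(** Both the numerator and the denominator vanish at the origin.  Writing the
    denominator as [z v] with [v = 1 + O(z)], the claimed difference times [v] is
    [T / z], where [T] is the numerator minus the claimed polynomial times the
    denominator; the terms of [T] of order below [4] cancel. *)
Lemma quotient_jet (lam : R) (f : C -> C) (b2 b3 : C) :
  has_jet f b2 b3 ->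
  bigO 3 (fun z => PSL_quotient lam f z -
    (1 + (1 + lam) * b2 * z
     + (2 * (1 + 2 * lam) * b3 - (1 + lam) * (1 + lam) * (b2 * b2)) * (z * z)))%C.
Proof.
intros (J0 & J1 & J2).
set (R0 := fun z => _) in J0; set (R1 := fun z => _) in J1; set (R2 := fun z => _) in J2.
set (d2 := ((1 + lam) * b2)%C); set (d3 := ((1 + 2 * lam) * b3)%C).
set (R := fun z => ((1 - lam) * R0 z + lam * z * R1 z)%C).
assert (OR : bigO 4 R) by (unfold R; bigO_calc).
assert (OR' : bigO 3 (fun z => R z / z)%C) by (apply bigO_div_id; exact OR).
assert (R00 := bigO_at_0 _ _ OR).
set (v := fun z => (1 + d2 * z + d3 * (z * z) + R z / z)%C).
assert (N1 : RtoC 1 <> 0) by (apply RtoC_neq_0; lra).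
assert (Ov : bigO 1 (fun z => v z - 1)%C).
{ apply (bigO_ext _ (fun z => d2 * z + d3 * (z * z) + R z / z)%C); [intros; unfold v; ring|].
  bigO_calc. }
destruct (bigO_near_nonzero v 1 N1 Ov) as (d & Hd & Nv).
apply (bigO_div _ _ v 1 N1 Ov).
set (P := fun z => (1 + d2 * z + (2 * d3 - d2 * d2) * (z * z))%C).
set (T := fun z => (z * R1 z + lam * (z * z) * R2 z - P z * R z
   - (z * z * z * z) * (d2 * d3 + (2 * d3 - d2 * d2) * d2 + (2 * d3 - d2 * d2) * d3 * z))%C).
assert (OT : bigO 4 T) by (unfold T, P; bigO_calc).
apply (bigO_ext_near _ (fun z => T z / z)%C _ d Hd); [|apply bigO_div_id; exact OT].
intros z Hz; unfold PSL_quotient.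
destruct (Ceq_dec z 0) as [->|Nz].
- rewrite (bigO_at_0 _ _ OT); unfold Cdiv; ring.
- assert (ED : ((1 - lam) * f z + lam * z * C_derive f z = z * v z)%C).
  { unfold v, R, R0, R1, d2, d3; field; auto. }
  rewrite ED.
  assert (EN : (z * C_derive f z + lam * z ^ 2 * C_derive (C_derive f) z
     - P z * (z * v z) = T z)%C).
  { unfold T; replace (z * v z)%C with (z + d2 * (z * z) + d3 * (z * z * z) + R z)%C
      by (unfold v; field; auto).
    unfold P, R1, R2, d2, d3; ring. }
  replace (1 + d2 * z
     + (2 * (1 + 2 * lam) * b3 - (1 + lam) * (1 + lam) * (b2 * b2)) * (z * z))%C
    with (P z) by (unfold P, d2, d3; ring).
  rewrite <- EN; field; split; auto.
Qed.

Lemma p_tilde_jet (kappa : R) :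
  bigO 3 (fun z => p_tilde kappa z -
    (1 + kappa * tau kappa * z + (kappa ^ 2 + 2)%R * (tau kappa * tau kappa) * (z * z)))%C.
Proof.
set (t := tau kappa).
set (v := fun z : C => (1 - kappa * t * z - t * t * (z * z))%C).
assert (N1 : RtoC 1 <> 0) by (apply RtoC_neq_0; lra).
assert (Ov : bigO 1 (fun z => v z - 1)%C).
{ apply (bigO_ext _ (fun z => - (kappa * t * z + t * t * (z * z)))%C); [intros; unfold v; ring|].
  bigO_calc. }
destruct (bigO_near_nonzero v 1 N1 Ov) as (d & Hd & Nv).
apply (bigO_div _ _ v 1 N1 Ov).
set (k2 := ((kappa * kappa + 2) * (t * t))%C).
apply (bigO_ext_near _ (fun z => (z * z * z) * (k2 * (kappa * t) + kappa * t * (t * t) + k2 * (t * t) * z))%C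
  _ d Hd); [|bigO_calc].
intros z Hz; specialize (Nv z Hz); unfold p_tilde; fold t.
replace ((kappa ^ 2 + 2)%R * (t * t))%C with k2
  by (unfold k2; rewrite RtoC_plus, RtoC_pow; simpl; ring).
replace (1 - kappa * t * z - t ^ 2 * z ^ 2)%C with (v z) by (unfold v; simpl; ring).
replace (((1 + t ^ 2 * z ^ 2) / v z - (1 + kappa * t * z + k2 * (z * z))) * v z)%C
  with ((1 + t ^ 2 * z ^ 2) - (1 + kappa * t * z + k2 * (z * z)) * v z)%C by (field; auto).
unfold v, k2; simpl; ring.
Qed.

(** Since [p1 <> 0], the equation [F z = G (omega z)] can be solved for the first
    two coefficients of [omega]: a first use of it gives
    [omega z = c1 z + O(z^2)], and inserting this in the quadratic term gives the
    next order. *)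
Lemma subordinate_second_coefficient (F G : C -> C) (q1 q2 p1 p2 : C) :
  p1 <> 0 -> subordinate F G ->
  bigO 3 (fun z => F z - (1 + q1 * z + q2 * (z * z)))%C ->
  bigO 3 (fun z => G z - (1 + p1 * z + p2 * (z * z)))%C ->
  exists c1 c2, (q1 = p1 * c1)%C /\ (q2 = p1 * c2 + p2 * (c1 * c1))%C /\
    Cmod c2 <= 1 - Cmod c1 ^ 2.
Proof.
intros Np (w & Aw & w0 & Hw) OF OG.
assert (Dw := analytic_cdiff w Aw).
assert (Ow : bigO 1 w) by (apply cdiff_bigO_1; auto; apply Dw; rewrite Cmod_0; lra).
assert (OGw := bigO_comp _ _ _ OG Ow); cbv beta in OGw.
set (RF := fun z => _) in OF; set (RG := fun z => _) in OGw.
set (c1 := (q1 / p1)%C); set (c2 := ((q2 - p2 * (c1 * c1)) / p1)%C).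
exists c1, c2.
assert (E1 : (q1 = p1 * c1)%C) by (unfold c1; field; auto).
assert (E2 : (q2 = p1 * c2 + p2 * (c1 * c1))%C) by (unfold c2; field; auto).
repeat split; auto.
assert (EFG : forall z, Cmod z < 1 ->
  (w z = / p1 * (q1 * z + q2 * (z * z) + RF z - RG z - p2 * (w z * w z)))%C).
{ intros z Hz; destruct (Hw z Hz) as [_ E]; unfold RF, RG; rewrite E; field; auto. }
set (S1 := fun z => (w z - c1 * z)%C).
assert (O1 : bigO 2 S1).
{ apply (bigO_ext_near _ (fun z => / p1 * (q2 * (z * z) + RF z - RG z - p2 * (w z * w z)))%C _ 1 Rlt_0_1);
   [|bigO_calc].
  intros z Hz; unfold S1; rewrite (EFG z Hz) at 3; unfold c1; field; auto. }
apply (schwarz_pick_second_coefficient w c1 c2 Dw).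
{ intros z Hz; apply Hw; auto. }
apply (bigO_ext_near _ (fun z => / p1 * (RF z - RG z - p2 * (S1 z * (w z + c1 * z))))%C _ 1 Rlt_0_1);
  [|bigO_calc].
intros z Hz.
replace (w z - c1 * z - c2 * (z * z))%C
  with (/ p1 * (q1 * z + q2 * (z * z) + RF z - RG z - p2 * (w z * w z)) - c1 * z - c2 * (z * z))%C
  by (rewrite <- (EFG z Hz); auto).
unfold S1; rewrite E2, E1; field; auto.
Qed.

(** * The coefficient bounds *)

(** In this and the two following lemmas [w] is [a2^2] and [c], [d] are the second
    coefficients of the two Schwarz functions.  Their first coefficients both
    have squared modulus [h |w|], so the Schwarz-Pick inequality links [c] and [d]
    to [w] itself. *)
Lemma coupled_bound_square (A K h : R) (w c d : C) :
  0 < A -> 0 < K -> 0 <= h -> (2 * A * w = K * (c + d))%C ->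
  Cmod c <= 1 - h * Cmod w -> Cmod d <= 1 - h * Cmod w ->
  Cmod w * (A + h * K) <= K.
Proof.
intros HA HK Hh E Hc Hd.
assert (N : Cmod (2 * A * w) = Cmod (K * (c + d))) by now rewrite E.
rewrite !Cmod_mult, !Cmod_R, !Rabs_right in N by lra.
pose proof (Cmod_triangle c d); nra.
Qed.

(** Here [nu w = m (c + d)] with [m = nu K / (2 A)].  If [m <= Q] the combination
    [(m - Q) c + (m + Q) d] has coefficients of total weight [2 Q].  Otherwise it
    is [(m - Q) (c + d) + 2 Q d], whose first term is a multiple of [w] and
    whose second is bounded by the Schwarz-Pick inequality; the resulting bound is
    affine in [n = |w|], hence at most the larger of its values at the two ends
    of [0 <= n <= K / (A + h K)], which are the two members of the maximum. *)
Lemma coupled_bound_pos (A K h Q nu : R) (w c d : C) :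
  0 < A -> 0 < K -> 0 <= h -> 0 <= Q -> 0 <= nu -> (2 * A * w = K * (c + d))%C ->
  Cmod c <= 1 - h * Cmod w -> Cmod d <= 1 - h * Cmod w ->
  Cmod (nu * w - Q * (c - d)) <= Rmax (2 * Q) (nu * K / (A + h * K)).
Proof.
intros HA HK Hh HQ Hnu E Hc Hd.
assert (Hn := coupled_bound_square A K h w c d HA HK Hh E Hc Hd).
assert (n0 := Cmod_ge_0 w); set (n := Cmod w) in *.
set (B := A + h * K) in *.
assert (HB : 0 < B) by (unfold B; nra).
set (m := nu * K / (2 * A)).
assert (m0 : 0 <= m) by (apply Rdiv_le_0_compat; nra).
assert (Ew : (nu * w = m * (c + d))%C).
{ unfold m; rewrite RtoC_div, !RtoC_mult by lra.
  assert (NA : RtoC A <> 0) by (apply RtoC_neq_0; lra).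
  replace (nu * K / (2 * A) * (c + d))%C with (nu / (2 * A) * (K * (c + d)))%C by (field; auto).
  rewrite <- E; field; auto. }
rewrite Ew.
destruct (Rle_dec m Q) as [L|L].
- eapply Rle_trans; [|apply Rmax_l].
  replace (m * (c + d) - Q * (c - d))%C with ((m - Q)%R * c + (m + Q)%R * d)%C
    by (rewrite RtoC_minus, RtoC_plus; ring).
  eapply Rle_trans; [apply Cmod_triangle|]; rewrite !Cmod_mult, !Cmod_R.
  rewrite Rabs_left1, Rabs_right by lra.
  assert (0 <= h * n) by nra.
  pose proof (Cmod_ge_0 c); pose proof (Cmod_ge_0 d); nra.
- apply Rnot_le_lt in L.
  replace (m * (c + d) - Q * (c - d))%C with ((m - Q)%R * (c + d) + (2 * Q)%R * d)%C
    by (rewrite RtoC_minus, RtoC_mult; ring).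
  assert (N : Cmod (c + d) = 2 * A * n / K).
  { assert (N : Cmod (2 * A * w) = Cmod (K * (c + d))) by now rewrite E.
    rewrite !Cmod_mult, !Cmod_R, !Rabs_right in N by lra.
    fold n in N; rewrite N; field; lra. }
  assert (T : Cmod ((m - Q)%R * (c + d) + (2 * Q)%R * d) <= 2 * Q + n * (nu - 2 * Q * B / K)).
  { eapply Rle_trans; [apply Cmod_triangle|]; rewrite !Cmod_mult, !Cmod_R.
    rewrite !Rabs_right, N by lra.
    replace (2 * Q + n * (nu - 2 * Q * B / K))
      with ((m - Q) * (2 * A * n / K) + 2 * Q * (1 - h * n)) by (unfold m, B; field; lra).
    apply Rplus_le_compat_l, Rmult_le_compat_l; lra. }
  eapply Rle_trans; [exact T|].
  assert (Hn' : n <= K / B) by (apply Rmult_le_reg_r with B; auto; unfold Rdiv; rewrite Rmult_assoc, Rinv_l; lra).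
  destruct (Rle_dec nu (2 * Q * B / K)) as [M|M].
  + eapply Rle_trans; [|apply Rmax_l]; nra.
  + eapply Rle_trans; [|apply Rmax_r].
    replace (nu * K / B) with (2 * Q + K / B * (nu - 2 * Q * B / K)) by (field; lra).
    apply Rplus_le_compat_l, Rmult_le_compat_r; lra.
Qed.

Lemma coupled_bound (A K h Q nu : R) (w c d : C) :
  0 < A -> 0 < K -> 0 <= h -> 0 <= Q -> (2 * A * w = K * (c + d))%C ->
  Cmod c <= 1 - h * Cmod w -> Cmod d <= 1 - h * Cmod w ->
  Cmod (nu * w - Q * (c - d)) <= Rmax (2 * Q) (Rabs nu * K / (A + h * K)).
Proof.
intros HA HK Hh HQ E Hc Hd.
destruct (Rle_dec 0 nu) as [L|L].
- rewrite (Rabs_right nu) by lra; now apply coupled_bound_pos.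
- rewrite (Rabs_left nu) by lra.
  replace (nu * w - Q * (c - d))%C with (- ((- nu)%R * w - Q * (d - c)))%C
    by (rewrite RtoC_opp; ring).
  rewrite Cmod_opp; apply coupled_bound_pos; auto; [lra|].
  rewrite E; ring.
Qed.

Ltac push_RtoC :=
  repeat (rewrite RtoC_minus || rewrite RtoC_mult || rewrite RtoC_plus
          || rewrite RtoC_opp || rewrite RtoC_pow).

Lemma tau_neg kappa : 0 < kappa -> tau kappa < 0.
Proof.
intros H; unfold tau.
assert (kappa < sqrt (kappa ^ 2 + 4)); [|lra].
rewrite <- (sqrt_pow2 kappa) at 1 by lra; apply sqrt_lt_1; nra.
Qed.

(** The four relations obtained by comparing coefficients in the two
    subordinations, the inverse having second and third coefficients [- a2] and
    [2 a2^2 - a3]. *)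
Lemma PSL_coefficients (kappa lam : R) (f : C -> C) (a : nat -> C) :
  0 < kappa -> normalized_expansion a f -> PSL kappa lam f ->
  let t := tau kappa in
  let q2 := fun b2 b3 : C => (2 * (1 + 2 * lam) * b3 - (1 + lam) * (1 + lam) * (b2 * b2))%C in
  let a2 := a 2%nat in let a3 := a 3%nat in
  exists c1 c2 d1 d2 : C,
    ((1 + lam) * a2 = kappa * t * c1)%C /\
    (q2 a2 a3 = kappa * t * c2 + (kappa ^ 2 + 2)%R * (t * t) * (c1 * c1))%C /\
    ((1 + lam) * - a2 = kappa * t * d1)%C /\
    (q2 (- a2) (2 * (a2 * a2) - a3) = kappa * t * d2 + (kappa ^ 2 + 2)%R * (t * t) * (d1 * d1))%C /\
    Cmod c2 <= 1 - Cmod c1 ^ 2 /\ Cmod d2 <= 1 - Cmod d1 ^ 2.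
Proof.
intros Hk Hexp (g & (_ & Uf & Ug & Inv) & [_ Sf] & [_ Sg]); cbv zeta.
destruct (normalized_expansion_jet a f Hexp) as [Jf Df].
assert (Jg := inverse_jet f g _ _ Jf Df Uf Ug Inv).
assert (Nt : (kappa * tau kappa)%C <> 0).
{ rewrite <- RtoC_mult; intros E; injection E.
  pose proof (tau_neg kappa Hk); nra. }
destruct (subordinate_second_coefficient _ _ _ _ _ _ Nt Sf (quotient_jet lam f _ _ Jf) (p_tilde_jet kappa))
  as (c1 & c2 & Ec1 & Ec2 & Hc).
destruct (subordinate_second_coefficient _ _ _ _ _ _ Nt Sg (quotient_jet lam g _ _ Jg) (p_tilde_jet kappa))
  as (d1 & d2 & Ed1 & Ed2 & Hd).
exists c1, c2, d1, d2; repeat split; auto.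
Qed.

Theorem theorem2p4 (kappa lam : R) (f : C -> C) (a : nat -> C)
    (hkappa : 0 < kappa) (hlam : 0 <= lam <= 1)
    (hexp : normalized_expansion a f) (hf : PSL kappa lam f) :
  let t := tau kappa in
  let B := kappa ^ 2 * t * (1 + 2 * lam - lam ^ 2)
           + (kappa - (kappa ^ 2 + 2) * t) * (1 + lam) ^ 2 in
  Cmod (a 2%nat) <= Rabs (kappa * t) * sqrt kappa / sqrt B /\
  Cmod (a 3%nat) <=
    Rabs (kappa * t) * (kappa - 2 * (kappa ^ 2 + 1) * t) * (1 + lam) ^ 2
    / (2 * (1 + 2 * lam) * B) /\
  forall mu : R,
    (0 <= Rabs (mu - 1) <= B / (2 * kappa ^ 2 * Rabs t * (1 + 2 * lam)) ->
     Cmod (a 3%nat - mu * a 2%nat ^ 2)%C <= Rabs (kappa * t) / (2 + 4 * lam)) /\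
    (Rabs (mu - 1) >= B / (2 * kappa ^ 2 * Rabs t * (1 + 2 * lam)) ->
     Cmod (a 3%nat - mu * a 2%nat ^ 2)%C
       <= Rabs (1 - mu) * kappa ^ 3 * t ^ 2 / B).
Proof.
intros t B.
destruct (PSL_coefficients kappa lam f a hkappa hexp hf)
  as (c1 & c2 & d1 & d2 & Ec1 & Ec2 & Ed1 & Ed2 & Hc & Hd).
fold t in Ec1, Ec2, Ed1, Ed2.
assert (ht : t < 0) by (apply tau_neg; auto).
set (a2 := a 2%nat) in *; set (a3 := a 3%nat) in *.
set (A := kappa ^ 2 * t * (1 + 2 * lam - lam ^ 2) - (kappa ^ 2 + 2) * t * (1 + lam) ^ 2).
assert (HA : 0 < A).
{ unfold A; replace (_ - _) with (- t * (2 * kappa ^ 2 * lam ^ 2 + 2 * (1 + lam) ^ 2)) by ring; apply Rmult_lt_0_compat; [lra|]; assert (0 <= kappa ^ 2 * lam ^ 2) by (apply Rmult_le_pos; apply pow2_ge_0); nra. }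
set (K := kappa ^ 3 * t ^ 2).
assert (HK : 0 < K) by (unfold K; apply Rmult_lt_0_compat; [apply pow_lt; auto|nra]).
set (h := (1 + lam) ^ 2 / (kappa * t) ^ 2).
assert (kt : kappa * t < 0) by nra.
assert (hkt : 0 < (kappa * t) ^ 2) by (simpl; nra).
assert (Hh : 0 <= h) by (apply Rdiv_le_0_compat; [nra|auto]).
set (Q := kappa * - t / (4 * (1 + 2 * lam))).
assert (HQ : 0 <= Q) by (apply Rdiv_le_0_compat; nra).
assert (EB : A + h * K = B) by (unfold A, h, K, B; field; split; lra).
set (w := (a2 * a2)%C).
assert (Ew : Cmod w = Cmod a2 ^ 2) by (unfold w; rewrite Cmod_mult; ring).
(* [Esum] is kappa^2 t times the sum of [Ec2] and [Ed2], the first coefficients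
   being eliminated by [Sc1] and [Sd1]; [Ediff] is their difference *)
assert (Sc1 : (kappa * t * c1 * (kappa * t * c1) = (1 + lam) * (1 + lam) * w)%C)
  by (rewrite <- Ec1; unfold w; ring).
assert (Sd1 : (kappa * t * d1 * (kappa * t * d1) = (1 + lam) * (1 + lam) * w)%C)
  by (rewrite <- Ed1; unfold w; ring).
rewrite RtoC_plus, RtoC_pow in Ec2, Ed2.
assert (Esum : (2 * A * w = K * (c2 + d2))%C).
{ unfold A, K; push_RtoC.
  transitivity (kappa * kappa * t * ((kappa * t * c2 + (kappa ^ 2 + 2) * (t * t) * (c1 * c1))
       + (kappa * t * d2 + (kappa ^ 2 + 2) * (t * t) * (d1 * d1)))
     - (kappa ^ 2 + 2) * t * (kappa * t * c1 * (kappa * t * c1) + kappa * t * d1 * (kappa * t * d1)))%C.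
  - rewrite <- Ec2, <- Ed2, Sc1, Sd1; unfold w; simpl; ring.
  - simpl; ring. }
assert (k0 : RtoC kappa <> 0) by (apply RtoC_neq_0; lra).
assert (t0 : RtoC t <> 0) by (apply RtoC_neq_0; lra).
assert (Ed1' : d1 = (- c1)%C).
{ transitivity (/ (kappa * t) * (kappa * t * d1))%C; [field; auto|].
  rewrite <- Ed1; replace ((1 + lam) * - a2)%C with (- ((1 + lam) * a2))%C by ring.
  rewrite Ec1; field; auto. }
assert (Ediff : (a3 - w = - (Q * (c2 - d2)))%C).
{ unfold Q. rewrite RtoC_div by lra; push_RtoC.
  assert (N : (1 + 2 * lam)%C <> 0) by (rewrite <- RtoC_mult, <- RtoC_plus; intros F; injection F; lra).
  transitivity (((2 * (1 + 2 * lam) * a3 - (1 + lam) * (1 + lam) * (a2 * a2))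
    - (2 * (1 + 2 * lam) * (2 * (a2 * a2) - a3) - (1 + lam) * (1 + lam) * (- a2 * - a2)))
     / (4 * (1 + 2 * lam)))%C.
  - unfold w; field; auto.
  - rewrite Ec2, Ed2, Ed1'; field; auto. }
assert (Hc1 : Cmod c1 ^ 2 = h * Cmod w).
{ assert (M : Cmod (kappa * t * c1 * (kappa * t * c1)) = Cmod ((1 + lam) * (1 + lam) * w)) by now rewrite Sc1.
  rewrite <- RtoC_mult, <- RtoC_plus, !Cmod_mult, !Cmod_R in M.
  rewrite Rabs_left, Rabs_right in M by lra.
  unfold h; apply Rmult_eq_reg_l with ((kappa * t) ^ 2); [|lra].
  transitivity ((1 + lam) * (1 + lam) * Cmod w); [rewrite <- M; ring|field; split; nra]. }
assert (Hd1 : Cmod d1 ^ 2 = h * Cmod w) by (rewrite Ed1', Cmod_opp; exact Hc1).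
rewrite Hc1 in Hc; rewrite Hd1 in Hd.
assert (HB : 0 < B) by (rewrite <- EB; nra).
assert (Hw := coupled_bound_square A K h w c2 d2 HA HK Hh Esum Hc Hd); rewrite EB in Hw.
assert (Fek : forall mu : R, Cmod (a3 - mu * a2 ^ 2)%C <= Rmax (2 * Q) (Rabs (1 - mu) * K / B)).
{ intros mu; rewrite <- EB.
  replace (a3 - mu * a2 ^ 2)%C with ((1 - mu)%R * w - Q * (c2 - d2))%C.
  - now apply coupled_bound.
  - rewrite RtoC_minus.
    replace (Q * (c2 - d2))%C with (- (a3 - w))%C by (rewrite Ediff; ring).
    unfold w; simpl; ring. }
assert (EQ : 2 * Q = Rabs (kappa * t) / (2 + 4 * lam)).
{ rewrite Rabs_left by nra; unfold Q; field; lra. }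
(* the threshold for |mu - 1| is where the two members of the maximum agree *)
assert (T2 : B / (2 * kappa ^ 2 * Rabs t * (1 + 2 * lam)) * (K / B) = 2 * Q).
{ rewrite Rabs_left by auto; unfold K, Q; field; repeat split; lra. }
assert (KB : 0 < K / B) by now apply Rdiv_lt_0_compat.
split; [|split].
- rewrite Rabs_left by nra.
  assert (sB : 0 < sqrt B) by now apply sqrt_lt_R0.
  apply Rmult_le_reg_r with (sqrt B); auto.
  unfold Rdiv; rewrite Rmult_assoc, Rinv_l, Rmult_1_r by lra.
  apply Rsqr_incr_0_var; [|apply Rmult_le_pos; [nra|apply sqrt_pos]].
  rewrite !Rsqr_mult, !Rsqr_sqrt by lra.
  rewrite Ew in Hw; unfold Rsqr; unfold K in Hw; simpl in Hw; lra.
- replace a3 with (w + - (Q * (c2 - d2)))%C by (rewrite <- Ediff; ring).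
  eapply Rle_trans; [apply Cmod_triangle|].
  rewrite Cmod_opp, Cmod_mult, Cmod_R, (Rabs_right Q) by lra.
  assert (Cmod (c2 - d2) <= 2).
  { unfold Cminus; eapply Rle_trans; [apply Cmod_triangle|]; rewrite Cmod_opp.
    pose proof (Cmod_ge_0 w); nra. }
  assert (Cmod w <= K / B) by (apply Rmult_le_reg_r with B; auto; unfold Rdiv; rewrite Rmult_assoc, Rinv_l; lra).
  apply Rle_trans with (K / B + Q * 2); [apply Rplus_le_compat; auto; apply Rmult_le_compat_l; auto|].
  rewrite Rabs_left by nra.
  right; apply Rmult_eq_reg_r with B; [|lra].
  replace ((K / B + Q * 2) * B) with (K + 2 * Q * B) by (field; lra).
  match goal with |- _ = ?X / (?Y * B) * B =>
    replace (X / (Y * B) * B) with (X / Y) by (field; lra) end.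
  unfold Q, K, B; field; lra.
- intros mu; rewrite (Rabs_minus_sym mu 1); split; intros Hmu.
  + rewrite <- EQ; eapply Rle_trans; [apply Fek|]; apply Rmax_lub; [lra|].
    rewrite <- T2; replace (Rabs (1 - mu) * K / B) with (Rabs (1 - mu) * (K / B)) by (field; lra).
    apply Rmult_le_compat_r; [left; exact KB|lra].
  + replace (Rabs (1 - mu) * kappa ^ 3 * t ^ 2 / B) with (Rabs (1 - mu) * K / B)
      by (unfold K; field; lra).
    eapply Rle_trans; [apply Fek|]; apply Rmax_lub; [|lra].
    rewrite <- T2; replace (Rabs (1 - mu) * K / B) with (Rabs (1 - mu) * (K / B)) by (field; lra).
    apply Rmult_le_compat_r; [left; exact KB|lra].
Qed.
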